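(* For $\chi\in\mathcal{A}$ let $R_i^\chi$ ($i=1,2,3$) be the $\mathcal{S}^*_{car}$-radius of $\mathcal{F}_i^\chi$. Then: (a) $\chi(z)=z$: $R_1^\chi=1/(4+\sqrt{17})$, $R_2^\chi=1/(3+2\sqrt3)$, $R_3^\chi=1/(2+\sqrt5)$. (b) $\chi(z)=z/(1+z)$: $R_1^\chi=5-2\sqrt6$, $R_2^\chi=\sqrt{17}-4$, $R_3^\chi=3-2\sqrt2$. (c) $\chi(z)=z/(1-z^2)$: $R_1^\chi=r_1$, $R_2^\chi=r_2$, $R_3^\chi=r_3$, where $r_1,r_2,r_3$ are the smallest positive real roots in $(0,1)$ of $3r^4-8r^3-4r^2-8r+1=0$, $r^4-6r^3-6r^2-6r+1=0$ and $3r^4-4r^3-4r^2-4r+1=0$ respectively ($r_1\approx0.11667$, $r_2\approx0.14326$, $r_3\approx0.20213$). (d) $\chi(z)=z/(1-z)^2$: $R_1^\chi=(6-\sqrt{33})/3$, $R_2^\chi=5-2\sqrt6$, $R_3^\chi=(4-\sqrt{13})/3$. (e) $\chi(z)=z+z^2/2$: $R_1^\chi=s_1$, $R_2^\chi=s_2$, $R_3^\chi=s_3$, where $s_1,s_2,s_3$ are the smallest positive real roots in $(0,1)$ of $3r^3+6r^2-19r+2=0$, $5r^3-15r+2=0$ and $3r^3+2r^2-11r+2=0$ respectively ($s_1\approx0.10924$, $s_2\approx0.13414$, $s_3\approx0.19028$). All estimates are sharp.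
   Context: $\mathbb{D}=\{z:|z|<1\}$; $\mathcal{A}$ is the class of analytic $f$ on $\mathbb{D}$ with $f(0)=0$, $f'(0)=1$. $F\prec G$ means $F=G\circ w$ for an analytic $w:\mathbb{D}\to\mathbb{D}$ with $w(0)=0$. $\mathcal{S}^*_{car}$ is the class of $f\in\mathcal{A}$ with $zf'(z)/f(z)\prec 1+z+z^2/2$. For $\chi\in\mathcal{A}$: $\mathcal{F}_1^\chi$ is the class of $f\in\mathcal{A}$ such that $\operatorname{Re}(f(z)/g(z))>0$ on $\mathbb{D}$ for some $g\in\mathcal{A}$ with $\operatorname{Re}(g(z)/\chi(z))>0$ on $\mathbb{D}$; $\mathcal{F}_2^\chi$ is the class of $f\in\mathcal{A}$ such that $|f(z)/g(z)-1|<1$ on $\mathbb{D}$ for some $g\in\mathcal{A}$ with $\operatorname{Re}(g(z)/\chi(z))>0$ on $\mathbb{D}$; $\mathcal{F}_3^\chi$ is the class of $f\in\mathcal{A}$ with $\operatorname{Re}(f(z)/\chi(z))>0$ on $\mathbb{D}$. For a class $\mathcal{F}\subseteq\mathcal{A}$, the $\mathcal{S}^*_{car}$-radius of $\mathcal{F}$ is the supremum of all $r\in(0,1]$ such that $f(rz)/r\in\mathcal{S}^*_{car}$ for every $f\in\mathcal{F}$. *)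

(* Defs.v *)
From Stdlib Require Import Reals.
From Coquelicot Require Import Coquelicot.
Open Scope R_scope.

Definition inD (z : C) : Prop := Cmod z < 1.

Definition cderiv (f : C -> C) (z : C) (l : C) : Prop :=
  @is_derive C_AbsRing C_NormedModule f z l.

Definition analytic_D (f : C -> C) : Prop :=
  forall z, inD z -> exists l, cderiv f z l.

Definition classA (f : C -> C) : Prop :=
  analytic_D f /\ f 0%C = 0%C /\ cderiv f 0%C 1%C.

Definition schwarz (w : C -> C) : Prop :=
  analytic_D w /\ (forall z, inD z -> inD (w z)) /\ w 0%C = 0%C.

Definition phi_car (z : C) : C := (1 + z + z * z / 2)%C.

(* S*_car: f in A with z f'(z)/f(z) subordinate to phi_car, i.e.
   z f'(z)/f(z) = phi_car (w z) on D for a Schwarz function w.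
   At z = 0 the quotient z f'(z)/f(z) is understood as its limit 1
   (= phi_car (w 0)), so the identity is imposed for z <> 0; it includes
   that f(z) <> 0 there, so the quotient is a genuine analytic function. *)
Definition Scar (f : C -> C) : Prop :=
  classA f /\
  exists w, schwarz w /\
    forall z, inD z -> z <> 0%C ->
      f z <> 0%C /\ exists d, cderiv f z d /\ (z * d / f z)%C = phi_car (w z).

(* Re(f/g) > 0 on D.  At z = 0 the quotient (of two functions of A) is
   the removable-singularity value 1, so the condition is imposed on D \ {0};
   with Coquelicot's total division (x / 0 = 0) it forces g z <> 0. *)
Definition re_quot_pos (f g : C -> C) : Prop :=
  forall z, inD z -> z <> 0%C -> 0 < Re (f z / g z)%C.

(* |f/g - 1| < 1 on D (same convention at z = 0, where the value is 0). *)
Definition quot_disk (f g : C -> C) : Prop :=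
  forall z, inD z -> z <> 0%C -> Cmod (f z / g z - 1)%C < 1.

Definition F1 (chi : C -> C) (f : C -> C) : Prop :=
  classA f /\ exists g, classA g /\ re_quot_pos g chi /\ re_quot_pos f g.

Definition F2 (chi : C -> C) (f : C -> C) : Prop :=
  classA f /\ exists g, classA g /\ re_quot_pos g chi /\ quot_disk f g.

Definition F3 (chi : C -> C) (f : C -> C) : Prop :=
  classA f /\ re_quot_pos f chi.

Definition radius_set (F : (C -> C) -> Prop) (r : R) : Prop :=
  0 < r <= 1 /\
  forall f, F f -> Scar (fun z => (f (RtoC r * z) / RtoC r)%C).

Definition Scar_radius (F : (C -> C) -> Prop) (Rad : R) : Prop :=
  is_lub (radius_set F) Rad.

Definition radii (chi : C -> C) (a b c : R) : Prop :=
  Scar_radius (F1 chi) a /\ Scar_radius (F2 chi) b /\ Scar_radius (F3 chi) c.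

Definition least_root_01 (P : R -> R) (r : R) : Prop :=
  0 < r < 1 /\ P r = 0 /\ forall s, 0 < s < r -> P s <> 0.

Definition chi_a (z : C) : C := z.
Definition chi_b (z : C) : C := (z / (1 + z))%C.
Definition chi_c (z : C) : C := (z / (1 - z * z))%C.
Definition chi_d (z : C) : C := (z / ((1 - z) * (1 - z)))%C.
Definition chi_e (z : C) : C := (z + z * z / 2)%C.

(* Main.v *)
Require Import Defs.
From Stdlib Require Import Reals Lra Lia Psatz ClassicalEpsilon.
From Coquelicot Require Import Coquelicot.
Open Scope R_scope.

(** Write [f = z p1 p2 X] with [X = chi / z], so that [z f' / f] is the sum of
    [1 + z X' / X] and of the logarithmic derivatives [z p' / p].  The first lies in an explicit
    disc, and the Herglotz representation bounds the others by [2 r / (1 - r^2)] when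
    [Re p > 0], and by [r / (1 - r)] when [|p - 1| < 1].  On the other hand the image of the
    unit disc under [phi_car] contains every disc [|q - a| < a - 1/2] with [1/2 < a <= 3/2],
    because [2 phi_car w - 1 = (1 + w)^2].  Comparing the two discs gives the radius.  For
    sharpness, products of [(1 + c z) / (1 - c z)] and [1 + c z] attain all bounds at once, at
    a point where [z f' / f] takes the boundary value [1/2].

    The complex analysis rests on Goursat's theorem: pulled back along the exponential, the
    rectangle theorem says that circle means are constant on annuli, which gives the mean value
    property with one exceptional point and then Cauchy's formula. *)

(** * Complex differentiability *)

(** The constants come from [phi_car] on the real axis: [phi_car (-1) = 1/2] is its value at its
    critical point, and the centre bound [3/2] is where the right end [2 a - 1/2] of the disc
    reaches [phi_car 1 = 5/2]. Only the left end of the disc around [z f' / f] decides the radius,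
    so sharpness asks every factor to push to the left at one and the same point; a unimodular [c]
    with [c z = - r] there arranges this.

    The subordinating function has to be analytic and is built from [f'], whereas analyticity is
    defined as mere pointwise differentiability. Hence the derivative must be shown differentiable,
    which is what Cauchy's formula is for. The exceptional point of the mean value property is the
    point of a difference quotient, where only continuity is known in advance.

    No estimate may lose a constant. For [Re p > 0], the bound for [p'] and the value of [Re p] are
    the same integral against the Poisson kernel up to explicit factors, so comparing them gives the
    sharp inequality. *)

Lemma cderiv_eps (f : C -> C) (z l : C) :
  cderiv f z l <->
  forall eps, 0 < eps -> exists d, 0 < d /\
    forall y, Cmod (y - z) < d ->
      Cmod (f y - f z - l * (y - z)) <= eps * Cmod (y - z).
Proof.
  split.
  - intros [_ H] eps He.
    destruct (H z (fun P HP => HP) (mkposreal eps He)) as [d Hd].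
    exists d; split; [apply cond_pos|]. intros y Hy.
    specialize (Hd y Hy).
    change (Cmod (f y - f z - (y - z) * l) <= eps * Cmod (y - z)) in Hd.
    rewrite (Cmult_comm l). exact Hd.
  - intros H. split; [apply is_linear_scal_l|].
    intros x Hx. rewrite <- (is_filter_lim_locally_unique _ _ Hx).
    intros eps. destruct (H eps (cond_pos eps)) as [d [Hd H1]].
    exists (mkposreal d Hd). intros y Hy. specialize (H1 y Hy).
    change (Cmod (f y - f z - (y - z) * l) <= eps * Cmod (y - z)).
    rewrite (Cmult_comm _ l). exact H1.
Qed.

Lemma cderiv_unique f z l l' : cderiv f z l -> cderiv f z l' -> l = l'.
Proof.
  intros H H'.
  rewrite <- (is_C_derive_unique _ _ _ H). apply is_C_derive_unique. exact H'.
Qed.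

Lemma cderiv_eq f z l m : l = m -> cderiv f z l -> cderiv f z m.
Proof. intros ->. exact (fun H => H). Qed.

Lemma cderiv_ext_near f g z l r :
  0 < r -> (forall y, Cmod (y - z) < r -> f y = g y) ->
  cderiv f z l -> cderiv g z l.
Proof.
  intros Hr H. apply is_derive_ext_loc.
  exists (mkposreal r Hr). intros y Hy. apply H. exact Hy.
Qed.

Lemma cderiv_ext f g z l :
  (forall y, f y = g y) -> cderiv f z l -> cderiv g z l.
Proof. intros H. apply (is_derive_ext (K := C_AbsRing) (V := C_NormedModule)). exact H. Qed.

Lemma cderiv_const (a z : C) : cderiv (fun _ => a) z 0.
Proof. apply (is_derive_const (K := C_AbsRing) (V := C_NormedModule)). Qed.

Lemma cderiv_id (z : C) : cderiv (fun y => y) z 1.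
Proof.
  apply cderiv_eps. intros eps He. exists 1; split; [lra|]. intros y _.
  replace (y - z - 1 * (y - z))%C with (RtoC 0) by ring.
  rewrite Cmod_0. apply Rmult_le_pos; [lra|apply Cmod_ge_0].
Qed.

Lemma cderiv_plus f g z l m :
  cderiv f z l -> cderiv g z m -> cderiv (fun y => f y + g y)%C z (l + m)%C.
Proof. apply (is_derive_plus (K := C_AbsRing) (V := C_NormedModule)). Qed.

Lemma cderiv_minus f g z l m :
  cderiv f z l -> cderiv g z m -> cderiv (fun y => f y - g y)%C z (l - m)%C.
Proof. apply (is_derive_minus (K := C_AbsRing) (V := C_NormedModule)). Qed.

(** The product rule, and the chain rule for its inner function, are stated for the ring as a module
    over itself. The two module structures give the same estimate up to conversion; only the
    linearity part is rebuilt. *)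
Lemma cderiv_AbsRing f z l :
  cderiv f z l <-> is_derive (K := C_AbsRing) (V := AbsRing_NormedModule C_AbsRing) f z l.
Proof.
  split; intros [_ H]; (split; [apply is_linear_scal_l|exact H]).
Qed.

Lemma cderiv_mult f g z l m :
  cderiv f z l -> cderiv g z m ->
  cderiv (fun y => f y * g y)%C z (l * g z + f z * m)%C.
Proof.
  rewrite !cderiv_AbsRing. intros Hf Hg.
  exact (is_derive_mult (K := C_AbsRing) f g z l m Hf Hg Cmult_comm).
Qed.

Lemma cderiv_comp f g z l m :
  cderiv f (g z) l -> cderiv g z m -> cderiv (fun y => f (g y)) z (l * m)%C.
Proof.
  rewrite (cderiv_AbsRing g), (Cmult_comm l). intros Hf Hg.
  exact (is_derive_comp (K := C_AbsRing) (V := C_NormedModule) f g z l m Hf Hg).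
Qed.

(** Reciprocal, square root and Cauchy-type integrals are all differentiated by this criterion:
    their remainders are explicit multiples of [(y - z)^2], and such a bound passes through a mean
    over the circle. *)
Lemma cderiv_quad f z l K r :
  0 < r ->
  (forall y, Cmod (y - z) < r ->
     Cmod (f y - f z - l * (y - z)) <= K * (Cmod (y - z) * Cmod (y - z))) ->
  cderiv f z l.
Proof.
  intros Hr H. apply cderiv_eps. intros eps He.
  assert (HK := Rabs_pos K).
  exists (Rmin r (eps / (1 + Rabs K))). split.
  { apply Rmin_case; [lra|]. apply Rdiv_lt_0_compat; lra. }
  intros y Hy. assert (HY := Cmod_ge_0 (y - z)).
  eapply Rle_trans; [apply H; eapply Rlt_le_trans; [exact Hy|apply Rmin_l]|].
  rewrite <- Rmult_assoc. apply Rmult_le_compat_r; [lra|].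
  assert (Hy1 : Cmod (y - z) * (1 + Rabs K) < eps).
  { apply Rlt_le_trans with (eps / (1 + Rabs K) * (1 + Rabs K)).
    - apply Rmult_lt_compat_r; [lra|]. eapply Rlt_le_trans; [exact Hy|apply Rmin_r].
    - right; field; lra. }
  assert (K * Cmod (y - z) <= Rabs K * Cmod (y - z))
    by (apply Rmult_le_compat_r; [lra|apply Rle_abs]).
  nra.
Qed.

Lemma Cmod_minus_sym (a b : C) : Cmod (a - b) = Cmod (b - a).
Proof. rewrite <- Cmod_opp. f_equal. ring. Qed.

Lemma Cmod_triangle_minus (a b : C) : Cmod a - Cmod b <= Cmod (a - b).
Proof.
  assert (H := Cmod_triangle (a - b) b).
  replace (a - b + b)%C with a in H by ring. lra.
Qed.

Lemma Cmod_pos_neq (z : C) : 0 < Cmod z -> z <> 0.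
Proof. intros H. apply Cmod_gt_0. exact H. Qed.

Lemma cderiv_inv (z : C) : z <> 0 -> cderiv (fun y => / y)%C z (- / (z * z))%C.
Proof.
  intros Hz. assert (Hm := proj1 (Cmod_gt_0 z) Hz).
  (* The remainder is exactly [(y - z)^2 / (y z^2)], and [|y| > |z| / 2] on the chosen ball. *)
  apply cderiv_quad with (K := 2 / (Cmod z * Cmod z * Cmod z)) (r := Cmod z / 2);
    [lra|].
  intros y Hy.
  assert (Hy1 : Cmod z / 2 < Cmod y).
  { assert (H := Cmod_triangle_minus z y). rewrite Cmod_minus_sym in Hy. lra. }
  assert (Hy0 : y <> 0) by (apply Cmod_pos_neq; lra).
  replace (/ y - / z - - / (z * z) * (y - z))%C with
    ((y - z) * (y - z) * / (y * z * z))%C by (field; auto).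
  rewrite !Cmod_mult, Cmod_inv by (repeat apply Cmult_neq_0; auto).
  rewrite !Cmod_mult. rewrite Rmult_comm. apply Rmult_le_compat_r.
  - apply Rmult_le_pos; apply Cmod_ge_0.
  - replace (2 / (Cmod z * Cmod z * Cmod z)) with (/ (Cmod z / 2 * Cmod z * Cmod z))
      by (field; lra).
    apply Rinv_le_contravar.
    + repeat apply Rmult_lt_0_compat; lra.
    + repeat apply Rmult_le_compat_r; lra.
Qed.

Lemma cderiv_div f g z l m :
  cderiv f z l -> cderiv g z m -> g z <> 0 ->
  cderiv (fun y => f y / g y)%C z ((l * g z - f z * m) / (g z * g z))%C.
Proof.
  intros Hf Hg H0.
  replace ((l * g z - f z * m) / (g z * g z))%C with
    (l * / g z + f z * (- / (g z * g z) * m))%C by (field; auto).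
  apply (cderiv_mult f (fun y => / g y)%C); [exact Hf|].
  apply (cderiv_comp (fun y => / y)%C g); [apply cderiv_inv|]; assumption.
Qed.

Definition cdiff (f : C -> C) (z : C) := exists l, cderiv f z l.

Lemma cdiff_const (a : C) z : cdiff (fun _ => a) z.
Proof. eexists; apply cderiv_const. Qed.
Lemma cdiff_id z : cdiff (fun y => y) z.
Proof. eexists; apply cderiv_id. Qed.
Lemma cdiff_plus f g z : cdiff f z -> cdiff g z -> cdiff (fun y => f y + g y)%C z.
Proof. intros [? ?] [? ?]; eexists; apply cderiv_plus; eassumption. Qed.
Lemma cdiff_minus f g z : cdiff f z -> cdiff g z -> cdiff (fun y => f y - g y)%C z.
Proof. intros [? ?] [? ?]; eexists; apply cderiv_minus; eassumption. Qed.
Lemma cdiff_mult f g z : cdiff f z -> cdiff g z -> cdiff (fun y => f y * g y)%C z.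
Proof. intros [? ?] [? ?]; eexists; apply cderiv_mult; eassumption. Qed.
Lemma cdiff_div f g z :
  cdiff f z -> cdiff g z -> g z <> 0 -> cdiff (fun y => f y / g y)%C z.
Proof. intros [? ?] [? ?] ?; eexists; apply cderiv_div; eassumption. Qed.
Lemma cdiff_comp f g z : cdiff f (g z) -> cdiff g z -> cdiff (fun y => f (g y)) z.
Proof. intros [? ?] [? ?]; eexists; apply cderiv_comp; eassumption. Qed.

Definition ccont (f : C -> C) (z : C) :=
  forall eps, 0 < eps -> exists d, 0 < d /\
    forall y, Cmod (y - z) < d -> Cmod (f y - f z) < eps.

Lemma cdiff_ccont f z : cdiff f z -> ccont f z.
Proof.
  intros [l Hl] eps He.
  destruct (proj1 (cderiv_eps _ _ _) Hl 1 Rlt_0_1) as [d [Hd H]].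
  assert (HL := Cmod_ge_0 l).
  exists (Rmin d (eps / (1 + Cmod l))). split.
  { apply Rmin_case; [lra|]. apply Rdiv_lt_0_compat; lra. }
  intros y Hy.
  assert (Hy1 : Cmod (y - z) * (1 + Cmod l) < eps).
  { apply Rlt_le_trans with (eps / (1 + Cmod l) * (1 + Cmod l)).
    - apply Rmult_lt_compat_r; [lra|]. eapply Rlt_le_trans; [exact Hy|apply Rmin_r].
    - right; field; lra. }
  specialize (H y ltac:(eapply Rlt_le_trans; [exact Hy|apply Rmin_l])).
  replace (f y - f z)%C with ((f y - f z - l * (y - z)) + l * (y - z))%C by ring.
  eapply Rle_lt_trans; [apply Cmod_triangle|]. rewrite Cmod_mult. nra.
Qed.

Lemma Cmod_ge_abs_Im (z : C) : Rabs (Im z) <= Cmod z.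
Proof. eapply Rle_trans; [apply Rmax_r|apply Rmax_Cmod]. Qed.
Lemma Cmod_le_Re_Im (z : C) : Cmod z <= Rabs (Re z) + Rabs (Im z).
Proof.
  replace z with ((Re z, 0) + (0, Im z))%C at 1.
  - eapply Rle_trans; [apply Cmod_triangle|]. apply Rplus_le_compat.
    + change (Re z, 0) with (RtoC (Re z)). rewrite Cmod_R. lra.
    + unfold Cmod; simpl. replace (0 * (0 * 1) + Im z * (Im z * 1)) with (Rsqr (Im z)) by (unfold Rsqr; ring).
      rewrite sqrt_Rsqr_abs. lra.
  - destruct z; unfold Cplus; simpl; f_equal; ring.
Qed.

(** * Integrals of complex-valued functions *)

Definition rcont (u : R -> C) (t : R) :=
  continuity_pt (fun s => Re (u s)) t /\ continuity_pt (fun s => Im (u s)) t.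

Lemma rcont_const (c : C) t : rcont (fun _ => c) t.
Proof. split; apply continuity_pt_const; intros x y; reflexivity. Qed.

Lemma rcont_plus u v t : rcont u t -> rcont v t -> rcont (fun s => u s + v s)%C t.
Proof.
  intros [A B] [C D]. split.
  - exact (continuity_pt_plus _ _ _ A C).
  - exact (continuity_pt_plus _ _ _ B D).
Qed.

Lemma rcont_mult u v t : rcont u t -> rcont v t -> rcont (fun s => u s * v s)%C t.
Proof.
  intros [A B] [C D]. split.
  - exact (continuity_pt_minus _ _ _ (continuity_pt_mult _ _ _ A C)
             (continuity_pt_mult _ _ _ B D)).
  - exact (continuity_pt_plus _ _ _ (continuity_pt_mult _ _ _ A D)
             (continuity_pt_mult _ _ _ B C)).
Qed.

Lemma rcont_conj u t : rcont u t -> rcont (fun s => Cconj (u s)) t.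
Proof.
  intros [A B]. split; [exact A|]. exact (continuity_pt_opp _ _ B).
Qed.

Lemma rcont_RtoC v t : continuity_pt v t -> rcont (fun s => RtoC (v s)) t.
Proof.
  intros A. split; [exact A|]. apply continuity_pt_const. intros x y. reflexivity.
Qed.

Lemma rcont_minus u v t : rcont u t -> rcont v t -> rcont (fun s => u s - v s)%C t.
Proof.
  intros [A B] [C D]. split.
  - exact (continuity_pt_minus _ _ _ A C).
  - exact (continuity_pt_minus _ _ _ B D).
Qed.

Lemma continuity_pt_eps (v : R -> R) t :
  continuity_pt v t <->
  forall eps, 0 < eps -> exists d, 0 < d /\
    forall s, Rabs (s - t) < d -> Rabs (v s - v t) < eps.
Proof.
  split.
  - intros H eps He. destruct (H eps He) as [d [Hd K]]. exists d. split; [exact Hd|].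
    intros s Hs. destruct (Req_dec t s) as [<-|N].
    + unfold Rminus. rewrite Rplus_opp_r, Rabs_R0. exact He.
    + apply K. repeat split; [exact N|exact Hs].
  - intros H eps He. destruct (H eps He) as [d [Hd K]]. exists d. split; [exact Hd|].
    intros s [_ Hs]. apply K. exact Hs.
Qed.

Lemma rcont_comp F u t : ccont F (u t) -> rcont u t -> rcont (fun s => F (u s)) t.
Proof.
  intros HF [A B].
  assert (K : forall eps, 0 < eps -> exists d, 0 < d /\
    forall s, Rabs (s - t) < d -> Cmod (F (u s) - F (u t)) < eps).
  { intros eps He. destruct (HF eps He) as [d [Hd H]].
    destruct (proj1 (continuity_pt_eps _ _) A (d / 2) ltac:(lra)) as [d1 [Hd1 H1]].
    destruct (proj1 (continuity_pt_eps _ _) B (d / 2) ltac:(lra)) as [d2 [Hd2 H2]].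
    exists (Rmin d1 d2). split; [apply Rmin_case; lra|].
    intros s Hs. apply H. eapply Rle_lt_trans; [apply Cmod_le_Re_Im|].
    specialize (H1 s ltac:(eapply Rlt_le_trans; [exact Hs|apply Rmin_l])).
    specialize (H2 s ltac:(eapply Rlt_le_trans; [exact Hs|apply Rmin_r])).
    change (Re (u s - u t)) with (Re (u s) - Re (u t)).
    change (Im (u s - u t)) with (Im (u s) - Im (u t)). lra. }
  split; apply continuity_pt_eps; intros eps He;
    destruct (K eps He) as [d [Hd H]]; exists d; (split; [exact Hd|]);
    intros s Hs; (eapply Rle_lt_trans; [|apply (H s Hs)]).
  - apply (re_le_Cmod (F (u s) - F (u t))).
  - apply (Cmod_ge_abs_Im (F (u s) - F (u t))).
Qed.

Definition cint (u : R -> C) (a b : R) : C :=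
  (RInt (fun t => Re (u t)) a b, RInt (fun t => Im (u t)) a b).

Definition cintegrable (u : R -> C) (a b : R) :=
  ex_RInt (fun t => Re (u t)) a b /\ ex_RInt (fun t => Im (u t)) a b.

Lemma rcont_integrable u a b :
  a <= b -> (forall t, a <= t <= b -> rcont u t) -> cintegrable u a b.
Proof.
  intros Hab H. split; apply (ex_RInt_continuous (V := R_CompleteNormedModule));
    intros t; rewrite Rmin_left, Rmax_right by lra; intros Ht;
    apply continuity_pt_filterlim, H, Ht.
Qed.

Lemma cint_ext u v a b :
  a <= b -> (forall t, a <= t <= b -> u t = v t) -> cint u a b = cint v a b.
Proof.
  intros Hab H. unfold cint. f_equal; apply RInt_ext;
    rewrite Rmin_left, Rmax_right by lra; intros t Ht; rewrite H by lra; reflexivity.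
Qed.

Lemma cint_plus u v a b :
  cintegrable u a b -> cintegrable v a b ->
  cint (fun t => u t + v t)%C a b = (cint u a b + cint v a b)%C.
Proof.
  intros [A B] [A' B'].
  apply (f_equal2 (fun x y : R => (x, y) : C)).
  - exact (RInt_plus _ _ _ _ A A').
  - exact (RInt_plus _ _ _ _ B B').
Qed.

Lemma cint_conj u a b :
  cintegrable u a b -> cint (fun t => Cconj (u t)) a b = Cconj (cint u a b).
Proof.
  intros [A B].
  apply (f_equal2 (fun x y : R => (x, y) : C)); [reflexivity|].
  exact (RInt_opp _ _ _ B).
Qed.

Lemma cint_scal c u a b :
  cintegrable u a b -> cint (fun t => c * u t)%C a b = (c * cint u a b)%C.
Proof.
  intros [A B].
  assert (S : forall k v, ex_RInt v a b -> ex_RInt (fun t => k * v t) a b)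
    by (intros k v Hv; exact (ex_RInt_scal v a b k Hv)).
  assert (E : forall k v, ex_RInt v a b -> RInt (fun t => k * v t) a b = k * RInt v a b)
    by (intros k v Hv; exact (RInt_scal v a b k Hv)).
  apply (f_equal2 (fun x y : R => (x, y) : C)).
  - transitivity (Re c * RInt (fun t => Re (u t)) a b - Im c * RInt (fun t => Im (u t)) a b).
    2: reflexivity.
    rewrite <- !E by assumption.
    exact (RInt_minus _ _ _ _ (S (Re c) _ A) (S (Im c) _ B)).
  - transitivity (Re c * RInt (fun t => Im (u t)) a b + Im c * RInt (fun t => Re (u t)) a b).
    2: reflexivity.
    rewrite <- !E by assumption.
    exact (RInt_plus _ _ _ _ (S (Re c) _ B) (S (Im c) _ A)).
Qed.

Lemma cint_const c a b : cint (fun _ => c) a b = (c * RtoC (b - a))%C.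
Proof.
  unfold cint. rewrite !RInt_const. unfold scal; simpl. unfold mult; simpl.
  destruct c; unfold Cmult; simpl. f_equal; ring.
Qed.

Lemma cint_minus u v a b :
  cintegrable u a b -> cintegrable v a b ->
  cint (fun t => u t - v t)%C a b = (cint u a b - cint v a b)%C.
Proof.
  intros [A B] [A' B'].
  apply (f_equal2 (fun x y : R => (x, y) : C)).
  - exact (RInt_minus _ _ _ _ A A').
  - exact (RInt_minus _ _ _ _ B B').
Qed.

Lemma cint_Chasles u a b c :
  cintegrable u a b -> cintegrable u b c ->
  (cint u a b + cint u b c)%C = cint u a c.
Proof.
  intros [A B] [A' B']. unfold cint, Cplus; simpl.
  f_equal; apply (RInt_Chasles (V := R_CompleteNormedModule)); assumption.
Qed.

(** Applying the norm inequality to the pair as a whole, with [Cmod] as norm, avoids the factor that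
    separate bounds of real and imaginary part would cost; the sharp derivative bound needs constant
    1. *)
Lemma cint_norm_le u v a b :
  a <= b -> cintegrable u a b -> ex_RInt v a b ->
  (forall t, a <= t <= b -> Cmod (u t) <= v t) ->
  Cmod (cint u a b) <= RInt v a b.
Proof.
  intros Hab [A B] Hv H. rewrite Cmod_norm.
  apply (norm_RInt_le (V := C_R_NormedModule) u v a b); [exact Hab|intros t Ht; rewrite <- Cmod_norm; exact (H t Ht)| |].
  - apply (is_RInt_fct_extend_pair (U := R_NormedModule) (V := R_NormedModule));
      [exact (RInt_correct _ _ _ A)|exact (RInt_correct _ _ _ B)].
  - exact (RInt_correct _ _ _ Hv).
Qed.

Lemma cint_near_const u c M a b :
  a <= b -> cintegrable u a b ->
  (forall t, a <= t <= b -> Cmod (u t - c) <= M) ->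
  Cmod (cint u a b - c * RtoC (b - a)) <= M * (b - a).
Proof.
  intros Hab Hu H.
  assert (Hc : cintegrable (fun _ => c) a b) by (split; apply ex_RInt_const).
  rewrite <- (cint_const c a b), <- cint_minus by assumption.
  replace (M * (b - a)) with (RInt (fun _ => M) a b)
    by (rewrite RInt_const; apply Rmult_comm).
  apply cint_norm_le; [exact Hab| |apply ex_RInt_const|exact H].
  destruct Hu, Hc.
  split.
  - apply (ex_RInt_minus (V := R_NormedModule)
      (fun t => Re (u t)) (fun t => Re c)); assumption.
  - apply (ex_RInt_minus (V := R_NormedModule)
      (fun t => Im (u t)) (fun t => Im c)); assumption.
Qed.

(** * Goursat's theorem on rectangles *)

(** The intervals [[x n, x n + w / 2^n]] are nested: left ends increase ([up]), right ends decrease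
    ([dn]), so every left end is below every right end and the supremum of the left ends is a common
    point. *)
Lemma nested_halving (x : nat -> R) (w : R) :
  0 < w ->
  (forall n, x n <= x (S n) <= x n + (/ 2) ^ (S n) * w) ->
  exists X, forall n, x n <= X <= x n + (/ 2) ^ n * w.
Proof.
  intros Hw H.
  assert (up : forall n m, x n <= x (n + m)%nat).
  { intros n m. induction m as [|m IH]; [rewrite Nat.add_0_r; lra|].
    rewrite Nat.add_succ_r. specialize (H (n + m)%nat). lra. }
  assert (dn : forall n m, x (n + m)%nat + (/ 2) ^ (n + m) * w <= x n + (/ 2) ^ n * w).
  { intros n m. induction m as [|m IH]; [rewrite Nat.add_0_r; lra|].
    rewrite Nat.add_succ_r. specialize (H (n + m)%nat). simpl in *. lra. }
  assert (pw : forall n, 0 < (/ 2) ^ n * w)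
    by (intros n; apply Rmult_lt_0_compat; [apply pow_lt; lra|exact Hw]).
  assert (cross : forall m n, x m <= x n + (/ 2) ^ n * w).
  { intros m n. destruct (Nat.le_ge_cases m n) as [L|L].
    - specialize (up m (n - m)%nat). replace (m + (n - m))%nat with n in up by lia.
      specialize (pw n). lra.
    - specialize (dn n (m - n)%nat). replace (n + (m - n))%nat with m in dn by lia.
      specialize (pw m). lra. }
  destruct (completeness (fun v => exists n, v = x n)) as [X [HX1 HX2]].
  - exists (x 0%nat + (/ 2) ^ 0 * w). intros v [n ->]. apply cross.
  - exists (x 0%nat), 0%nat. reflexivity.
  - exists X. intros n. split.
    + apply HX1. exists n. reflexivity.
    + apply HX2. intros v [m ->]. apply cross.
Qed.

(* A subadditive rectangle functional that is [o(s^2)] at every point vanishes: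
   bisecting keeps a quarter with [mu >= e * s^2], and the quarters shrink to a point. *)
Lemma bisection (mu : R -> R -> R -> R) (x0 y0 w k : R) :
  0 < w -> 0 < k ->
  let inside x y s := x0 <= x /\ x + s * w <= x0 + w /\ y0 <= y /\ y + s * k <= y0 + k in
  (forall x y s, 0 < s -> inside x y s ->
     mu x y s <= mu x y (s / 2) + mu (x + s / 2 * w) y (s / 2)
       + mu x (y + s / 2 * k) (s / 2) + mu (x + s / 2 * w) (y + s / 2 * k) (s / 2)) ->
  (forall x y, x0 <= x <= x0 + w -> y0 <= y <= y0 + k -> forall eps, 0 < eps ->
     exists d, 0 < d /\ forall x' y' s, 0 < s < d -> inside x' y' s ->
       x' <= x <= x' + s * w -> y' <= y <= y' + s * k -> mu x' y' s <= eps * (s * s)) ->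
  mu x0 y0 1 <= 0.
Proof.
  intros Hw Hk inside Hsub Hloc. apply Rnot_lt_le. intros Hpos.
  (* Half of the assumed positive value, so that the starting rectangle satisfies the strict
     inequality of [good] at scale 1. *)
  set (e := mu x0 y0 1 / 2).
  assert (He : 0 < e) by (unfold e; lra).
  set (h := fun n : nat => (/ 2) ^ n).
  assert (hpos : forall n, 0 < h n) by (intros n; apply pow_lt; lra).
  set (good := fun n (p : R * R) =>
    inside (fst p) (snd p) (h n) /\ e * (h n * h n) < mu (fst p) (snd p) (h n)).
  assert (step : forall n (p : R * R), good n p -> exists q : R * R, good (S n) q /\
    fst p <= fst q <= fst p + h (S n) * w /\ snd p <= snd q <= snd p + h (S n) * k).
  { intros n [x y] [Hin Hmu]. simpl in Hin, Hmu. specialize (hpos n).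
    assert (HS : h (S n) = h n / 2) by (unfold h; simpl; field).
    specialize (Hsub x y (h n) hpos Hin). destruct Hin as [I1 [I2 [I3 I4]]].
    assert (Wp : 0 < h n * w) by (apply Rmult_lt_0_compat; lra).
    assert (Kp : 0 < h n * k) by (apply Rmult_lt_0_compat; lra).
    unfold good, inside. rewrite HS.
    set (s := h n) in *.
    (* If three quarters fail the strict bound, subadditivity forces it on the fourth, because
       [e * (s * s)] is four times [e * (s / 2 * (s / 2))]. *)
    destruct (Rlt_dec (e * (s / 2 * (s / 2))) (mu x y (s / 2))) as [L|L1];
      [exists (x, y); simpl; repeat split; try lra|].
    destruct (Rlt_dec (e * (s / 2 * (s / 2))) (mu (x + s / 2 * w) y (s / 2))) as [L|L2];
      [exists (x + s / 2 * w, y); simpl; repeat split; try lra|].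
    destruct (Rlt_dec (e * (s / 2 * (s / 2))) (mu x (y + s / 2 * k) (s / 2))) as [L|L3];
      [exists (x, y + s / 2 * k); simpl; repeat split; try lra|].
    exists (x + s / 2 * w, y + s / 2 * k); simpl; repeat split; try lra. }
  assert (start : good 0%nat (x0, y0)).
  { unfold good, inside, h; simpl. replace (mu x0 y0 1) with (2 * e) by (unfold e; field).
    repeat split; lra. }
  (* Dependent choice: each corner is stored with its proof of [good], which is what [step] consumes
     to produce the next one. *)
  pose (next := fun n (P : {p | good n p}) =>
    constructive_indefinite_description _ (step n (proj1_sig P) (proj2_sig P))).
  pose (seq := nat_rect (fun n => {p | good n p}) (exist _ (x0, y0) start)
    (fun n P => exist _ (proj1_sig (next n P)) (proj1 (proj2_sig (next n P))))).
  assert (seqS : forall n,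
    fst (proj1_sig (seq n)) <= fst (proj1_sig (seq (S n)))
      <= fst (proj1_sig (seq n)) + h (S n) * w /\
    snd (proj1_sig (seq n)) <= snd (proj1_sig (seq (S n)))
      <= snd (proj1_sig (seq n)) + h (S n) * k).
  { intros n. exact (proj2 (proj2_sig (next n (seq n)))). }
  destruct (nested_halving (fun n => fst (proj1_sig (seq n))) w Hw
    (fun n => proj1 (seqS n))) as [X HX].
  destruct (nested_halving (fun n => snd (proj1_sig (seq n))) k Hk
    (fun n => proj2 (seqS n))) as [Y HY].
  assert (HX0 := HX 0%nat). assert (HY0 := HY 0%nat). simpl in HX0, HY0.
  destruct (Hloc X Y ltac:(lra) ltac:(lra) e He) as [d [Hd K]].
  destruct (pow_lt_1_zero (/ 2) ltac:(rewrite Rabs_pos_eq; lra) d Hd) as [N HN].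
  specialize (HN N (le_n _)). rewrite Rabs_pos_eq in HN by (left; apply hpos).
  destruct (proj2_sig (seq N)) as [G1 G2].
  specialize (K _ _ (h N) (conj (hpos N) HN) G1 (HX N) (HY N)). lra.
Qed.

(* The boundary integral of [h(s) ds] over [[a,b] x [c,d]], opposite sides paired. *)
Definition rect_int (h : C -> C) (a b c d : R) : C :=
  (cint (fun x => h (x, c) - h (x, d)) a b + Ci * cint (fun y => h (b, y) - h (a, y)) c d)%C.

Lemma rcont_hline h (y x : R) : ccont h (x, y) -> rcont (fun t => h (t, y)) x.
Proof.
  intros H. apply (rcont_comp h (fun t => (t, y))); [exact H|].
  split; [apply continuity_pt_id|apply continuity_pt_const; intros p q; reflexivity].
Qed.

Lemma rcont_vline h (x y : R) : ccont h (x, y) -> rcont (fun t => h (x, t)) y.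
Proof.
  intros H. apply (rcont_comp h (fun t => (x, t))); [exact H|].
  split; [apply continuity_pt_const; intros p q; reflexivity|apply continuity_pt_id].
Qed.

Section Rectangle.
Variables (h : C -> C) (a b c d : R).
Hypothesis h_diff : forall x y, a <= x <= b -> c <= y <= d -> cdiff h (x, y).

Let h_hline x1 x2 y : a <= x1 <= x2 -> x2 <= b -> c <= y <= d ->
  cintegrable (fun t => h (t, y)) x1 x2.
Proof.
  intros H1 H2 H3. apply rcont_integrable; [lra|]. intros t Ht.
  apply rcont_hline, cdiff_ccont, h_diff; lra.
Qed.

Let h_vline y1 y2 x : c <= y1 <= y2 -> y2 <= d -> a <= x <= b ->
  cintegrable (fun t => h (x, t)) y1 y2.
Proof.
  intros H1 H2 H3. apply rcont_integrable; [lra|]. intros t Ht.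
  apply rcont_vline, cdiff_ccont, h_diff; lra.
Qed.

Lemma rect_int_sides x1 x2 y1 y2 :
  a <= x1 <= x2 -> x2 <= b -> c <= y1 <= y2 -> y2 <= d ->
  rect_int h x1 x2 y1 y2 =
  (cint (fun x => h (x, y1)) x1 x2 - cint (fun x => h (x, y2)) x1 x2
   + Ci * (cint (fun y => h (x2, y)) y1 y2 - cint (fun y => h (x1, y)) y1 y2))%C.
Proof.
  intros H1 H2 H3 H4. unfold rect_int. f_equal; [|f_equal].
  - apply (cint_minus (fun x => h (x, y1)) (fun x => h (x, y2))); apply h_hline; lra.
  - apply (cint_minus (fun y => h (x2, y)) (fun y => h (x1, y))); apply h_vline; lra.
Qed.

Lemma rect_int_split x1 x2 x3 y1 y2 y3 :
  a <= x1 <= x2 -> x2 <= x3 <= b -> c <= y1 <= y2 -> y2 <= y3 <= d ->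
  rect_int h x1 x3 y1 y3 =
  (rect_int h x1 x2 y1 y2 + rect_int h x2 x3 y1 y2
   + rect_int h x1 x2 y2 y3 + rect_int h x2 x3 y2 y3)%C.
Proof.
  intros H1 H2 H3 H4. rewrite !rect_int_sides by lra.
  rewrite <- (cint_Chasles (fun x => h (x, y1)) x1 x2 x3) by (apply h_hline; lra).
  rewrite <- (cint_Chasles (fun x => h (x, y3)) x1 x2 x3) by (apply h_hline; lra).
  rewrite <- (cint_Chasles (fun x => h (x1, x)) y1 y2 y3) by (apply h_vline; lra).
  rewrite <- (cint_Chasles (fun x => h (x3, x)) y1 y2 y3) by (apply h_vline; lra).
  ring.
Qed.

(** Pairing opposite sides cancels the constant part of the affine approximation, leaving integrands
    within [2 e] of the constants [l i (y1 - y2)] and [l (x2 - x1)]. Their contributions to the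
    boundary integral are opposite multiples of the area, so only the error terms survive. *)
Lemma rect_int_small x1 x2 y1 y2 s l e :
  a <= x1 <= x2 -> x2 <= b -> c <= y1 <= y2 -> y2 <= d -> 0 <= e ->
  (forall x y, x1 <= x <= x2 -> y1 <= y <= y2 ->
    Cmod (h (x, y) - h s - l * ((x, y) - s)) <= e) ->
  Cmod (rect_int h x1 x2 y1 y2) <= 2 * e * ((x2 - x1) + (y2 - y1)).
Proof.
  intros H1 H2 H3 H4 He H. unfold rect_int.
  set (A := cint _ x1 x2). set (B := cint _ y1 y2).
  assert (HA : Cmod (A - l * Ci * RtoC (y1 - y2) * RtoC (x2 - x1)) <= 2 * e * (x2 - x1)).
  { apply cint_near_const; [lra| |].
    - apply rcont_integrable; [lra|]. intros t Ht.
      apply rcont_minus; apply rcont_hline, cdiff_ccont, h_diff; lra.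
    - intros t Ht.
      replace (h (t, y1) - h (t, y2) - l * Ci * (y1 - y2)%R)%C with
        ((h (t, y1) - h s - l * ((t, y1) - s)) - (h (t, y2) - h s - l * ((t, y2) - s)))%C.
      + unfold Cminus at 1. eapply Rle_trans; [apply Cmod_triangle|]. rewrite Cmod_opp.
        assert (K1 := H t y1 ltac:(lra) ltac:(lra)).
        assert (K2 := H t y2 ltac:(lra) ltac:(lra)). lra.
      + replace (Ci * (y1 - y2)%R)%C with ((t, y1) - (t, y2))%C
          by (unfold Ci, Cminus, Cmult, Cplus, Copp, RtoC; simpl; f_equal; ring).
        ring_simplify. rewrite <- Cmult_assoc.
        replace (Ci * (y1 - y2)%R)%C with ((t, y1) - (t, y2))%C
          by (unfold Ci, Cminus, Cmult, Cplus, Copp, RtoC; simpl; f_equal; ring).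
        ring. }
  assert (HB : Cmod (B - l * RtoC (x2 - x1) * RtoC (y2 - y1)) <= 2 * e * (y2 - y1)).
  { apply cint_near_const; [lra| |].
    - apply rcont_integrable; [lra|]. intros t Ht.
      apply rcont_minus; apply rcont_vline, cdiff_ccont, h_diff; lra.
    - intros t Ht.
      replace (h (x2, t) - h (x1, t) - l * (x2 - x1)%R)%C with
        ((h (x2, t) - h s - l * ((x2, t) - s)) - (h (x1, t) - h s - l * ((x1, t) - s)))%C.
      + unfold Cminus at 1. eapply Rle_trans; [apply Cmod_triangle|]. rewrite Cmod_opp.
        assert (K1 := H x2 t ltac:(lra) ltac:(lra)).
        assert (K2 := H x1 t ltac:(lra) ltac:(lra)). lra.
      + replace (RtoC (x2 - x1)) with ((x2, t) - (x1, t))%C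
          by (unfold Cminus, Cplus, Copp, RtoC; simpl; f_equal; ring).
        ring. }
  replace (A + Ci * B)%C with
    ((A - l * Ci * RtoC (y1 - y2) * RtoC (x2 - x1))
     + Ci * (B - l * RtoC (x2 - x1) * RtoC (y2 - y1)))%C
    by (rewrite !RtoC_minus; ring).
  eapply Rle_trans; [apply Cmod_triangle|]. rewrite Cmod_mult, Cmod_Ci. lra.
Qed.

Lemma goursat_rectangle : a < b -> c < d -> rect_int h a b c d = 0.
Proof.
  intros Hab Hcd.
  assert (Hw : 0 < b - a) by lra. assert (Hk : 0 < d - c) by lra.
  set (w := b - a) in *. set (k := d - c) in *.
  apply Cmod_eq_0. apply Rle_antisym; [|apply Cmod_ge_0].
  replace b with (a + 1 * w) by (unfold w; ring).
  replace d with (c + 1 * k) by (unfold k; ring).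
  apply (bisection (fun x y s => Cmod (rect_int h x (x + s * w) y (y + s * k))) a c w k Hw Hk).
  - intros x y s Hs [I1 [I2 [I3 I4]]].
    assert (0 < s * w) by (apply Rmult_lt_0_compat; lra).
    assert (0 < s * k) by (apply Rmult_lt_0_compat; lra).
    rewrite (rect_int_split x (x + s / 2 * w) (x + s * w) y (y + s / 2 * k) (y + s * k))
      by (unfold w, k in *; lra).
    replace (x + s / 2 * w + s / 2 * w) with (x + s * w) by field.
    replace (y + s / 2 * k + s / 2 * k) with (y + s * k) by field.
    do 3 (eapply Rle_trans; [apply Cmod_triangle|]; apply Rplus_le_compat_r).
    lra.
  - intros x y Hx Hy eps He.
    destruct (h_diff x y ltac:(unfold w in *; lra) ltac:(unfold k in *; lra)) as [l Hl].
    assert (Hwk : 0 < 2 * (w + k) * (w + k)) by (repeat apply Rmult_lt_0_compat; lra).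
    (* A copy at scale [s] has diameter and half-perimeter at most [s (w + k)]; the remainder on it
       is at most [e s (w + k)], and [rect_int_small] then yields [2 e s^2 (w + k)^2 = eps s^2]. *)
    set (e := eps / (2 * (w + k) * (w + k))).
    assert (He' : 0 < e) by (apply Rdiv_lt_0_compat; lra).
    destruct (proj1 (cderiv_eps _ _ _) Hl e He') as [dl [Hdl K]].
    exists (dl / (w + k)). split; [apply Rdiv_lt_0_compat; lra|].
    intros x' y' s [Hs Hsd] [I1 [I2 [I3 I4]]] Hx' Hy'.
    assert (0 < s * w) by (apply Rmult_lt_0_compat; lra).
    assert (0 < s * k) by (apply Rmult_lt_0_compat; lra).
    assert (Hsd' : s * (w + k) < dl).
    { apply Rlt_le_trans with (dl / (w + k) * (w + k)).
      - apply Rmult_lt_compat_r; lra.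
      - right; field; lra. }
    assert (He2 : e * (2 * (w + k) * (w + k)) = eps) by (unfold e; field; lra).
    eapply Rle_trans.
    + apply (rect_int_small _ _ _ _ (x, y) l (e * (s * (w + k)))); try (unfold w, k in *; lra).
      * apply Rmult_le_pos; [lra|]. rewrite Rmult_plus_distr_l. lra.
      * intros p q Hp Hq.
        assert (D : Cmod ((p, q) - (x, y)) <= s * (w + k)).
        { eapply Rle_trans; [apply Cmod_le_Re_Im|]. simpl.
          rewrite Rmult_plus_distr_l.
          apply Rplus_le_compat; apply Rabs_le; lra. }
        eapply Rle_trans; [apply K; lra|]. apply Rmult_le_compat_l; lra.
    + right. rewrite <- He2. ring.
Qed.
End Rectangle.

(** * Circle means *)

Definition circ (r t : R) : C := (r * cos t, r * sin t).

(** The complex exponential in polar form: a vertical segment of height [2 PI] is sent to a full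
    circle with the angle itself as parameter. *)
Definition cexp (s : C) : C := circ (exp (fst s)) (snd s).

Definition cmean (u : R -> C) : C := (RtoC (/ (2 * PI)) * cint u 0 (2 * PI))%C.

Lemma Cmod_circ r t : 0 <= r -> Cmod (circ r t) = r.
Proof.
  intros Hr. unfold Cmod, circ; simpl.
  replace (r * cos t * (r * cos t * 1) + r * sin t * (r * sin t * 1))
    with (Rsqr r * (Rsqr (sin t) + Rsqr (cos t))) by (unfold Rsqr; ring).
  rewrite sin2_cos2, Rmult_1_r. apply sqrt_Rsqr, Hr.
Qed.

Lemma cexp_plus s t : cexp (s + t) = (cexp s * cexp t)%C.
Proof.
  unfold cexp, circ, Cmult, Cplus; simpl. rewrite exp_plus, cos_plus, sin_plus.
  f_equal; ring.
Qed.

Lemma derivable_pt_lim_eps f x l :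
  derivable_pt_lim f x l -> forall eps, 0 < eps -> exists d, 0 < d /\
    forall h, Rabs h < d -> Rabs (f (x + h) - f x - l * h) <= eps * Rabs h.
Proof.
  intros H eps He. destruct (H eps He) as [d Hd]. exists d. split; [apply cond_pos|].
  intros h Hh. destruct (Req_dec h 0) as [->|N].
  - replace (f (x + 0) - f x - l * 0) with 0 by (rewrite Rplus_0_r; ring).
    rewrite Rabs_R0. lra.
  - replace (f (x + h) - f x - l * h) with (((f (x + h) - f x) / h - l) * h)
      by (field; exact N).
    rewrite Rabs_mult. apply Rmult_le_compat_r; [apply Rabs_pos|].
    left. apply Hd; assumption.
Qed.

Lemma cderiv_cexp_0 : cderiv cexp 0 1.
Proof.
  apply cderiv_eps. intros eps He.
  (* The remainder splits into five terms built from the real remainders [E], [Q], [S] and from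
     [x y]. In units of [e m] they cost 1, 2, 1, 2 and 1, seven in all; [e <= 1] gives
     [|1 + x| <= 2]. *)
  set (e := Rmin 1 (eps / 7)).
  assert (He1 : 0 < e) by (apply Rmin_case; lra).
  assert (He2 : e <= 1) by apply Rmin_l.
  assert (He3 : e <= eps / 7) by apply Rmin_r.
  destruct (derivable_pt_lim_eps _ _ _ derivable_pt_lim_exp_0 e He1) as [d1 [Hd1 K1]].
  destruct (derivable_pt_lim_eps _ _ _ (derivable_pt_lim_cos 0) e He1) as [d2 [Hd2 K2]].
  destruct (derivable_pt_lim_eps _ _ _ (derivable_pt_lim_sin 0) e He1) as [d3 [Hd3 K3]].
  exists (Rmin e (Rmin d1 (Rmin d2 d3))).
  split; [repeat apply Rmin_case; lra|]. intros [x y] Hh.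
  replace ((x, y) - 0)%C with ((x, y) : C) in *
    by (unfold Cminus, Cplus, Copp, RtoC; simpl; f_equal; ring).
  assert (Hx := re_le_Cmod (x, y)). assert (Hy := Cmod_ge_abs_Im (x, y)).
  simpl in Hx, Hy.
  set (m := Cmod (x, y)) in *.
  assert (m < e /\ m < d1 /\ m < d2 /\ m < d3) as [M0 [M1 [M2 M3]]].
  { repeat split; (eapply Rlt_le_trans; [exact Hh|]).
    - apply Rmin_l.
    - eapply Rle_trans; [apply Rmin_r|apply Rmin_l].
    - eapply Rle_trans; [apply Rmin_r|]. eapply Rle_trans; [apply Rmin_r|apply Rmin_l].
    - eapply Rle_trans; [apply Rmin_r|]. eapply Rle_trans; [apply Rmin_r|apply Rmin_r]. }
  specialize (K1 x ltac:(lra)). specialize (K2 y ltac:(lra)). specialize (K3 y ltac:(lra)).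
  rewrite Rplus_0_l, exp_0 in K1. rewrite Rplus_0_l, cos_0, sin_0 in K2.
  rewrite Rplus_0_l, cos_0, sin_0 in K3.
  set (E := exp x - 1 - 1 * x) in *. set (Q := cos y - 1 - - 0 * y) in *.
  set (S := sin y - 0 - 1 * y) in *.
  replace (cexp (x, y) - cexp 0 - 1 * (x, y))%C with
    ((E * cos y + (1 + x) * Q, E * sin y + (1 + x) * S + x * y) : C)
    by (unfold E, Q, S, cexp, circ, Cminus, Cplus, Copp, Cmult, RtoC; simpl;
        rewrite exp_0, cos_0, sin_0; f_equal; ring).
  assert (Hm : 0 <= m) by apply Cmod_ge_0.
  assert (Em : Rabs E <= e * m) by (eapply Rle_trans; [exact K1|]; apply Rmult_le_compat_l; lra).
  assert (Qm : Rabs Q <= e * m) by (eapply Rle_trans; [exact K2|]; apply Rmult_le_compat_l; lra).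
  assert (Sm : Rabs S <= e * m) by (eapply Rle_trans; [exact K3|]; apply Rmult_le_compat_l; lra).
  assert (X2 : Rabs (1 + x) <= 2).
  { eapply Rle_trans; [apply Rabs_triang|]. rewrite Rabs_R1. lra. }
  assert (XY : Rabs x * Rabs y <= e * m) by (apply Rmult_le_compat; try apply Rabs_pos; lra).
  assert (T : forall p q, Rabs p <= 2 -> Rabs q <= e * m -> Rabs (p * q) <= 2 * (e * m)).
  { intros p q Hp Hq. rewrite Rabs_mult. apply Rmult_le_compat; try apply Rabs_pos; lra. }
  assert (T1 : forall p q, Rabs p <= e * m -> Rabs q <= 1 -> Rabs (p * q) <= e * m).
  { intros p q Hp Hq. rewrite Rabs_mult. rewrite <- (Rmult_1_r (e * m)).
    apply Rmult_le_compat; try apply Rabs_pos; lra. }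
  assert (C1 : Rabs (cos y) <= 1) by (apply Rabs_le, COS_bound).
  assert (S1 : Rabs (sin y) <= 1) by (apply Rabs_le, SIN_bound).
  eapply Rle_trans; [apply Cmod_le_Re_Im|]. simpl.
  assert (A1 := T1 _ _ Em C1). assert (A2 := T1 _ _ Em S1).
  assert (A3 := T _ _ X2 Qm). assert (A4 := T _ _ X2 Sm).
  assert (B1 := Rabs_triang (E * cos y) ((1 + x) * Q)).
  assert (B2 := Rabs_triang (E * sin y + (1 + x) * S) (x * y)).
  assert (B3 := Rabs_triang (E * sin y) ((1 + x) * S)).
  rewrite (Rabs_mult x y) in B2.
  assert (e * m <= eps / 7 * m) by (apply Rmult_le_compat_r; lra).
  lra.
Qed.

Lemma cderiv_cexp s : cderiv cexp s (cexp s).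
Proof.
  apply cderiv_ext with (f := fun y => (cexp s * cexp (y - s))%C).
  { intros y. rewrite <- cexp_plus. f_equal. ring. }
  apply cderiv_eq with (0 * cexp (s - s) + cexp s * (1 * (1 - 0)))%C; [ring|].
  apply (cderiv_mult (fun _ => cexp s) (fun y => cexp (y - s))); [apply cderiv_const|].
  apply (cderiv_comp cexp (fun y => y - s)%C).
  - replace (s - s)%C with (RtoC 0) by ring. apply cderiv_cexp_0.
  - apply cderiv_minus; [apply cderiv_id|apply cderiv_const].
Qed.

Lemma rcont_circ r t : rcont (circ r) t.
Proof.
  split; apply continuity_pt_mult.
  1, 3: apply continuity_pt_const; intros x y; reflexivity.
  - apply continuity_cos.
  - apply continuity_sin.
Qed.

Lemma circ_rcont F r :
  0 <= r -> (forall z, Cmod z = r -> ccont F z) -> forall t, rcont (fun s => F (circ r s)) t.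
Proof.
  intros Hr H t. apply (rcont_comp F (circ r)); [apply H, Cmod_circ, Hr|apply rcont_circ].
Qed.

Lemma PI2_pos : 0 < 2 * PI.
Proof. assert (H := PI_RGT_0). lra. Qed.

(** The rectangle is [[ln r1, ln r2] x [0, 2 PI]]. Its horizontal sides have the same image under
    [cexp] and cancel by periodicity; its vertical sides give exactly the two circle integrals with
    respect to the angle. *)
Lemma cmean_annulus F r1 r2 :
  0 < r1 < r2 -> (forall z, r1 <= Cmod z <= r2 -> cdiff F z) ->
  cmean (fun t => F (circ r1 t)) = cmean (fun t => F (circ r2 t)).
Proof.
  intros [H1 H2] HF. unfold cmean. f_equal.
  assert (P := PI2_pos).
  assert (L : ln r1 < ln r2) by (apply ln_increasing; lra).
  assert (D : forall x y, ln r1 <= x <= ln r2 -> 0 <= y <= 2 * PI ->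
    cdiff (fun s => F (cexp s)) (x, y)).
  { intros x y Hx _. apply cdiff_comp; [|eexists; apply cderiv_cexp].
    apply HF. unfold cexp. rewrite Cmod_circ by (left; apply exp_pos). simpl.
    rewrite <- (exp_ln r1), <- (exp_ln r2) by lra.
    assert (M : forall p q, p <= q -> exp p <= exp q).
    { intros p q [K| ->]; [left; apply exp_increasing, K|right; reflexivity]. }
    split; apply M; lra. }
  assert (G := goursat_rectangle (fun s => F (cexp s)) _ _ _ _ D L P).
  rewrite (rect_int_sides _ _ _ _ _ D) in G by lra.
  assert (E : cint (fun x => F (cexp (x, 0))) (ln r1) (ln r2)
            = cint (fun x => F (cexp (x, 2 * PI))) (ln r1) (ln r2)).
  { apply cint_ext; [lra|]. intros t _. unfold cexp, circ; simpl.
    rewrite cos_2PI, sin_2PI, cos_0, sin_0. reflexivity. }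
  rewrite E in G.
  assert (E1 : forall r, 0 < r -> cint (fun y => F (cexp (ln r, y))) 0 (2 * PI)
             = cint (fun t => F (circ r t)) 0 (2 * PI)).
  { intros r Hr. apply cint_ext; [lra|]. intros t _. unfold cexp; simpl.
    rewrite exp_ln by lra. reflexivity. }
  rewrite !E1 in G by lra.
  set (A := cint (fun t => F (circ r1 t)) 0 (2 * PI)) in *.
  set (B := cint (fun t => F (circ r2 t)) 0 (2 * PI)) in *.
  set (X := cint _ (ln r1) (ln r2)) in G.
  replace A with (B + Ci * (X - X + Ci * (B - A)))%C.
  - rewrite G. ring.
  - replace (B + Ci * (X - X + Ci * (B - A)))%C with (B + (Ci * Ci) * (B - A))%C by ring.
    replace (Ci * Ci)%C with (- (1))%C.
    + ring.
    + unfold Ci, Cmult, Copp, RtoC; simpl. f_equal; ring.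
Qed.

Lemma circ_cont_2d r t : forall eps, 0 < eps -> exists d, 0 < d /\
  forall t' r', Rabs (t' - t) < d -> Rabs (r' - r) < d ->
    Cmod (circ r' t' - circ r t) < eps.
Proof.
  intros eps He.
  assert (HR := Rabs_pos r).
  assert (H4 : 0 < eps / (4 * (1 + Rabs r))) by (apply Rdiv_lt_0_compat; lra).
  destruct (proj1 (continuity_pt_eps _ _) (continuity_cos t) _ H4) as [d1 [Hd1 K1]].
  destruct (proj1 (continuity_pt_eps _ _) (continuity_sin t) _ H4) as [d2 [Hd2 K2]].
  exists (Rmin (eps / 4) (Rmin d1 d2)). split; [repeat apply Rmin_case; lra|].
  intros t' r' Ht Hr.
  assert (Hr1 : Rabs (r' - r) < eps / 4) by (eapply Rlt_le_trans; [exact Hr|apply Rmin_l]).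
  specialize (K1 t' ltac:(eapply Rlt_le_trans; [exact Ht|];
    eapply Rle_trans; [apply Rmin_r|apply Rmin_l])).
  specialize (K2 t' ltac:(eapply Rlt_le_trans; [exact Ht|];
    eapply Rle_trans; [apply Rmin_r|apply Rmin_r])).
  assert (B : forall p q, Rabs p <= 1 -> Rabs (p - q) < eps / (4 * (1 + Rabs r)) ->
    Rabs (r' * p - r * q) < eps / 2).
  { intros p q Hp Hpq. replace (r' * p - r * q) with ((r' - r) * p + r * (p - q)) by ring.
    eapply Rle_lt_trans; [apply Rabs_triang|]. rewrite !Rabs_mult.
    assert (Rabs (r' - r) * Rabs p <= Rabs (r' - r) * 1)
      by (apply Rmult_le_compat_l; [apply Rabs_pos|exact Hp]).
    assert (Rabs r * Rabs (p - q) <= (1 + Rabs r) * (eps / (4 * (1 + Rabs r))))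
      by (apply Rmult_le_compat; try apply Rabs_pos; lra).
    replace ((1 + Rabs r) * (eps / (4 * (1 + Rabs r)))) with (eps / 4) in *
      by (field; lra).
    lra. }
  eapply Rle_lt_trans; [apply Cmod_le_Re_Im|].
  assert (C1 : Rabs (cos t') <= 1) by (apply Rabs_le, COS_bound).
  assert (S1 : Rabs (sin t') <= 1) by (apply Rabs_le, SIN_bound).
  assert (B1 := B _ _ C1 K1). assert (B2 := B _ _ S1 K2).
  change (Rabs (r' * cos t' - r * cos t) + Rabs (r' * sin t' - r * sin t) < eps).
  lra.
Qed.

Lemma cmean_const c : cmean (fun _ => c) = c.
Proof.
  unfold cmean. rewrite cint_const, Rminus_0_r. assert (P := PI2_pos).
  rewrite RtoC_inv by lra. field. intros K. apply RtoC_inj in K. lra.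
Qed.

Lemma cmean_norm_le_const u M :
  (forall t, rcont u t) -> (forall t, 0 <= t <= 2 * PI -> Cmod (u t) <= M) ->
  Cmod (cmean u) <= M.
Proof.
  intros Hu H. assert (P := PI2_pos). unfold cmean.
  assert (K := cint_near_const u 0 M 0 (2 * PI) ltac:(lra)
    ltac:(apply rcont_integrable; [lra|auto])).
  rewrite Cmod_mult, Cmod_R, Rabs_pos_eq by (left; apply Rinv_0_lt_compat, P).
  replace (cint u 0 (2 * PI) - 0 * (2 * PI - 0)%R)%C with (cint u 0 (2 * PI)) in K by ring.
  apply Rmult_le_reg_l with (2 * PI); [exact P|].
  rewrite <- Rmult_assoc, Rinv_r, Rmult_1_l by lra.
  rewrite Rminus_0_r, (Rmult_comm M) in K. apply K.
  intros t Ht. replace (u t - 0)%C with (u t) by ring. apply H, Ht.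
Qed.

Lemma cmean_plus u v :
  (forall t, rcont u t) -> (forall t, rcont v t) ->
  cmean (fun t => u t + v t)%C = (cmean u + cmean v)%C.
Proof.
  intros Hu Hv. assert (P := PI2_pos). unfold cmean.
  rewrite cint_plus by (apply rcont_integrable; [lra|auto]). ring.
Qed.

Lemma cmean_minus u v :
  (forall t, rcont u t) -> (forall t, rcont v t) ->
  cmean (fun t => u t - v t)%C = (cmean u - cmean v)%C.
Proof.
  intros Hu Hv. assert (P := PI2_pos). unfold cmean.
  rewrite cint_minus by (apply rcont_integrable; [lra|auto]). ring.
Qed.

Lemma cmean_scal c u :
  (forall t, rcont u t) -> cmean (fun t => c * u t)%C = (c * cmean u)%C.
Proof.
  intros Hu. assert (P := PI2_pos). unfold cmean.
  rewrite cint_scal by (apply rcont_integrable; [lra|auto]). ring.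
Qed.

Lemma cmean_conj u :
  (forall t, rcont u t) -> cmean (fun t => Cconj (u t)) = Cconj (cmean u).
Proof.
  intros Hu. assert (P := PI2_pos). unfold cmean.
  rewrite cint_conj by (apply rcont_integrable; [lra|auto]).
  rewrite Cmult_conj. f_equal. unfold Cconj, RtoC; simpl. f_equal. ring.
Qed.

Lemma cmean_ext u v : (forall t, u t = v t) -> cmean u = cmean v.
Proof.
  intros H. unfold cmean. f_equal. apply cint_ext; [left; apply PI2_pos|]. intros t _. apply H.
Qed.

(* Continuity in [r] is uniform in the angle by compactness of [0, 2 PI]. *)
Lemma cmean_cont F r R0 :
  0 <= r <= R0 -> (forall z, Cmod z <= R0 -> ccont F z) ->
  forall eps, 0 < eps -> exists d, 0 < d /\
    forall r', 0 <= r' <= R0 -> Rabs (r' - r) < d ->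
      Cmod (cmean (fun t => F (circ r' t)) - cmean (fun t => F (circ r t))) <= eps.
Proof.
  intros Hr HF eps He.
  assert (C2 : forall P : C -> R, (forall a b : C, Rabs (P a - P b) <= Cmod (a - b)) ->
    forall t, 0 <= t <= 2 * PI -> continuity_2d_pt (fun t r => P (F (circ r t))) t r).
  { intros P HP t Ht e.
    destruct (HF (circ r t) ltac:(rewrite Cmod_circ; lra) e (cond_pos e)) as [d1 [Hd1 K1]].
    destruct (circ_cont_2d r t d1 Hd1) as [d [Hd K]].
    exists (mkposreal d Hd). intros u v Hu Hv. simpl in Hu, Hv.
    eapply Rle_lt_trans; [apply HP|]. apply K1, K; assumption. }
  assert (He2 : 0 < eps / 2) by lra.
  destruct (uniform_continuity_2d_1d _ _ _ _ (C2 Re (fun a b => re_le_Cmod (a - b)))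
    (mkposreal _ He2)) as [d1 K1].
  destruct (uniform_continuity_2d_1d _ _ _ _ (C2 Im (fun a b => Cmod_ge_abs_Im (a - b)))
    (mkposreal _ He2)) as [d2 K2].
  simpl in K1, K2. assert (Hd1 := cond_pos d1). assert (Hd2 := cond_pos d2).
  exists (Rmin d1 d2). split; [apply Rmin_case; assumption|].
  intros r' Hr' Hd. assert (P := PI2_pos).
  assert (Hda : Rabs (r' - r) < d1) by (eapply Rlt_le_trans; [exact Hd|apply Rmin_l]).
  assert (Hdb : Rabs (r' - r) < d2) by (eapply Rlt_le_trans; [exact Hd|apply Rmin_r]).
  apply Rabs_def2 in Hda. apply Rabs_def2 in Hdb.
  assert (CR : forall p, 0 <= p <= R0 -> forall t, rcont (fun s => F (circ p s)) t).
  { intros p Hp. apply circ_rcont; [lra|]. intros z Hz. apply HF. lra. }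
  rewrite <- cmean_minus by (apply CR; assumption).
  apply cmean_norm_le_const; [intros t; apply rcont_minus; apply CR; assumption|].
  intros t Ht.
  eapply Rle_trans; [apply Cmod_le_Re_Im|].
  assert (D0 : Rabs (t - t) < d1 /\ Rabs (t - t) < d2).
  { unfold Rminus. rewrite Rplus_opp_r, Rabs_R0. split; assumption. }
  assert (A1 := K1 t r t r' Ht ltac:(lra) Ht ltac:(lra) (proj1 D0)).
  assert (A2 := K2 t r t r' Ht ltac:(lra) Ht ltac:(lra) (proj2 D0)).
  change (Rabs (Re (F (circ r' t)) - Re (F (circ r t)))
    + Rabs (Im (F (circ r' t)) - Im (F (circ r t))) <= eps). lra.
Qed.

Lemma C_eq_small (a b : C) : (forall eps, 0 < eps -> Cmod (a - b) <= eps) -> a = b.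
Proof.
  intros H. apply Ceq_minus, Cmod_eq_0, Rle_antisym; [|apply Cmod_ge_0].
  apply Rnot_lt_le. intros K. specialize (H (Cmod (a - b) / 2)). lra.
Qed.

(** The annulus lemma makes the circle mean constant for radii below [|z0|] and for radii above it.
    Continuity in the radius joins both pieces at [|z0|] and extends the constant down to radius 0,
    where the mean is [F 0]. So at [z0] continuity is enough. *)
Lemma mean_value F R0 z0 :
  0 < R0 -> Cmod z0 < R0 -> (forall z, Cmod z <= R0 -> ccont F z) ->
  (forall z, Cmod z <= R0 -> z <> z0 -> cdiff F z) ->
  cmean (fun t => F (circ R0 t)) = F 0.
Proof.
  intros HR Hz0 HC HD.
  set (M := fun r => cmean (fun t => F (circ r t))).
  assert (M0 : M 0 = F 0).
  { unfold M. rewrite <- (cmean_const (F 0)). unfold cmean. f_equal.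
    apply cint_ext; [assert (P := PI2_pos); lra|]. intros t _. unfold circ.
    rewrite !Rmult_0_l. reflexivity. }
  assert (Mc : forall r1 r2, 0 < r1 <= r2 -> r2 <= R0 -> Cmod z0 < r1 \/ r2 < Cmod z0 ->
    M r1 = M r2).
  { intros r1 r2 [H1 [H2| ->]] H3 H4; [|reflexivity].
    apply cmean_annulus; [lra|]. intros z Hz. apply HD; [lra|].
    intros ->. lra. }
  (* A limit principle: if the mean takes the value [K] at radii arbitrarily close to [r], it equals
     [K] at [r]. It is used from above and from below at [|z0|], and at 0. *)
  assert (Ml : forall r K s, 0 <= r <= R0 -> 0 < s ->
    (forall d, 0 < d < s -> exists r', 0 <= r' <= R0 /\ Rabs (r' - r) < d /\ M r' = K) ->
    M r = K).
  { intros r K s Hr Hs H. apply C_eq_small. intros eps He.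
    destruct (cmean_cont F r R0 Hr HC eps He) as [d [Hd H1]].
    destruct (H (Rmin d (s / 2))) as [r' [A [B <-]]].
    - split; [apply Rmin_case; lra|]. eapply Rle_lt_trans; [apply Rmin_r|lra].
    - rewrite Cmod_minus_sym. apply H1; [exact A|].
      eapply Rlt_le_trans; [exact B|apply Rmin_l]. }
  assert (Hz := Cmod_ge_0 z0). set (p := Cmod z0) in *.
  assert (E1 : M p = M R0).
  { apply (Ml p (M R0) (R0 - p)); [lra|lra|]. intros d Hd. exists (p + d / 2).
    split; [lra|]. split; [rewrite Rabs_pos_eq; lra|]. apply Mc; lra. }
  change (M R0 = F 0). rewrite <- M0, <- E1.
  destruct (Req_dec p 0) as [Z|Z]; [rewrite Z; reflexivity|].
  transitivity (M (p / 2)).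
  - apply (Ml p (M (p / 2)) p); [lra|lra|]. intros d Hd. exists (p - d / 2).
    split; [lra|]. split; [rewrite Rabs_minus_sym, Rabs_pos_eq; lra|].
    symmetry. apply Mc; lra.
  - symmetry. apply (Ml 0 (M (p / 2)) (p / 2)); [lra|lra|]. intros d Hd. exists (d / 2).
    split; [lra|]. split; [rewrite Rabs_pos_eq; lra|]. apply Mc; lra.
Qed.

(** * Cauchy's integral formula *)

Lemma rcont_inv (u : R -> C) t : u t <> 0 -> rcont u t -> rcont (fun s => / u s)%C t.
Proof.
  intros H Hu. apply (rcont_comp (fun z => / z)%C u); [|exact Hu].
  apply cdiff_ccont. eexists. apply cderiv_inv, H.
Qed.

Lemma rcont_div (u v : R -> C) t :
  v t <> 0 -> rcont u t -> rcont v t -> rcont (fun s => u s / v s)%C t.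
Proof. intros H Hu Hv. apply rcont_mult; [exact Hu|]. apply rcont_inv; assumption. Qed.

(** Differentiation under the integral sign: since the quadratic remainder is uniform in the angle,
    its mean obeys the same bound. *)
Lemma cderiv_cmean (k : C -> R -> C) (k' : R -> C) z K r :
  0 < r -> (forall y, Cmod (y - z) < r -> forall t, rcont (k y) t) ->
  (forall t, rcont k' t) ->
  (forall y t, Cmod (y - z) < r -> 0 <= t <= 2 * PI ->
     Cmod (k y t - k z t - k' t * (y - z)) <= K * (Cmod (y - z) * Cmod (y - z))) ->
  cderiv (fun y => cmean (k y)) z (cmean k').
Proof.
  intros Hr Hk Hk' H. apply cderiv_quad with K r; [exact Hr|]. intros y Hy.
  assert (Hz : Cmod (z - z) < r).
  { replace (z - z)%C with (RtoC 0) by ring. rewrite Cmod_0. exact Hr. }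
  rewrite (Cmult_comm _ (y - z)), <- (cmean_scal (y - z) k' Hk').
  assert (A := Hk y Hy). assert (B := Hk z Hz).
  assert (D : forall t, rcont (fun s => (y - z) * k' s)%C t)
    by (intros t; apply (rcont_mult (fun _ => y - z)%C); [apply rcont_const|apply Hk']).
  rewrite <- (cmean_minus (k y) (k z)) by assumption.
  rewrite <- (cmean_minus (fun t => k y t - k z t)%C)
    by (first [exact D|intros t; apply rcont_minus; auto]).
  apply cmean_norm_le_const.
  - intros t. apply (rcont_minus (fun s => k y s - k z s)%C); [|apply D].
    apply rcont_minus; auto.
  - intros t Ht. rewrite (Cmult_comm (y - z)). apply H; assumption.
Qed.

Lemma rcont_bounded u :
  (forall t, rcont u t) -> exists B, 0 <= B /\ forall t, 0 <= t <= 2 * PI -> Cmod (u t) <= B.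
Proof.
  intros Hu. assert (P := PI2_pos).
  destruct (continuity_ab_maj (fun t => Rabs (Re (u t)) + Rabs (Im (u t))) 0 (2 * PI))
    as [m [Hm _]]; [lra| |].
  - intros t _. apply continuity_pt_plus;
      [apply (continuity_pt_comp (fun t => Re (u t)) Rabs)
      |apply (continuity_pt_comp (fun t => Im (u t)) Rabs)];
      try apply Rcontinuity_abs; apply (Hu t).
  - eexists. split; [|intros t Ht; eapply Rle_trans; [apply Cmod_le_Re_Im|exact (Hm t Ht)]].
    apply Rplus_le_le_0_compat; apply Rabs_pos.
Qed.

Section Kernels.
Variables (u : R -> C) (r0 : R).
Hypothesis u_cont : forall t, rcont u t.
Hypothesis r0_pos : 0 < r0.

Lemma circ_minus_ge z t : r0 - Cmod z <= Cmod (circ r0 t - z).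
Proof.
  assert (H := Cmod_triangle_minus (circ r0 t) z). rewrite Cmod_circ in H; lra.
Qed.

Lemma circ_minus_neq z t : Cmod z < r0 -> (circ r0 t - z)%C <> 0.
Proof.
  intros H. apply Cmod_pos_neq. assert (K := circ_minus_ge z t). lra.
Qed.

Lemma rcont_circ_minus z t : rcont (fun s => circ r0 s - z)%C t.
Proof. apply (rcont_minus (circ r0) (fun _ => z)); [apply rcont_circ|apply rcont_const]. Qed.

(** The Cauchy transform with respect to the angle. As [d zeta = i zeta dt], the usual Cauchy
    integral of [f] is obtained from the data [u = f zeta], not from [u = f]. [cauchy2] is its
    derivative in [z]. *)
Definition cauchy1 (z : C) : C := cmean (fun t => u t / (circ r0 t - z))%C.
Definition cauchy2 (z : C) : C :=
  cmean (fun t => u t / ((circ r0 t - z) * (circ r0 t - z)))%C.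

Lemma rcont_cauchy1 z : Cmod z < r0 ->
  forall t, rcont (fun t => u t / (circ r0 t - z))%C t.
Proof.
  intros Hz t. apply (rcont_div u (fun t => circ r0 t - z)%C);
    [apply circ_minus_neq, Hz|apply u_cont|apply rcont_circ_minus].
Qed.

Lemma rcont_cauchy2 z : Cmod z < r0 ->
  forall t, rcont (fun t => u t / ((circ r0 t - z) * (circ r0 t - z)))%C t.
Proof.
  intros Hz t. apply (rcont_div u (fun t => (circ r0 t - z) * (circ r0 t - z))%C).
  - apply Cmult_neq_0; apply circ_minus_neq, Hz.
  - apply u_cont.
  - apply rcont_mult; apply rcont_circ_minus.
Qed.

Lemma near_half z y : Cmod z < r0 -> Cmod (y - z) < (r0 - Cmod z) / 2 ->
  Cmod y < r0 /\ forall t, (r0 - Cmod z) / 2 <= Cmod (circ r0 t - y).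
Proof.
  intros Hz Hy. assert (H := Cmod_triangle_minus y z). split; [lra|].
  intros t. assert (K := circ_minus_ge y t). lra.
Qed.

Lemma cderiv_cauchy1 z : Cmod z < r0 -> cderiv cauchy1 z (cauchy2 z).
Proof.
  intros Hz. destruct (rcont_bounded u u_cont) as [B [HB HuB]].
  set (d := r0 - Cmod z). assert (Hd : 0 < d) by (unfold d; lra).
  (* The remainder is [u (y - z)^2 / ((zeta - y) (zeta - z)^2)]; on the ball of radius [d / 2] the
     two distances are at least [d / 2] and [d]. *)
  apply (cderiv_cmean (fun y t => u t / (circ r0 t - y))%C _ z
    (B * / (d / 2 * (d * d))) (d / 2)).
  - lra.
  - intros y Hy. apply rcont_cauchy1. apply (near_half z y Hz Hy).
  - apply rcont_cauchy2, Hz.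
  - intros y t Hy Ht. destruct (near_half z y Hz Hy) as [Hy1 Hy2].
    assert (N1 := circ_minus_neq y t Hy1). assert (N2 := circ_minus_neq z t Hz).
    specialize (Hy2 t). fold d in Hy2. assert (Hz2 := circ_minus_ge z t). fold d in Hz2.
    replace (u t / (circ r0 t - y) - u t / (circ r0 t - z)
      - u t / ((circ r0 t - z) * (circ r0 t - z)) * (y - z))%C with
      (u t * / ((circ r0 t - y) * ((circ r0 t - z) * (circ r0 t - z))) * ((y - z) * (y - z)))%C
      by (field; split; assumption).
    rewrite !Cmod_mult, Cmod_inv by (repeat apply Cmult_neq_0; assumption).
    rewrite !Cmod_mult. apply Rmult_le_compat_r.
    { apply Rmult_le_pos; apply Cmod_ge_0. }
    apply Rmult_le_compat; [apply Cmod_ge_0| |apply HuB, Ht|].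
    + left. apply Rinv_0_lt_compat. repeat apply Rmult_lt_0_compat; lra.
    + apply Rinv_le_contravar; [repeat apply Rmult_lt_0_compat; lra|].
      assert (0 <= d * d) by (apply Rmult_le_pos; lra).
      apply Rmult_le_compat; [lra|lra|lra|]. apply Rmult_le_compat; lra.
Qed.

Lemma cdiff_cauchy2 z : Cmod z < r0 -> cdiff cauchy2 z.
Proof.
  intros Hz. destruct (rcont_bounded u u_cont) as [B [HB HuB]].
  set (d := r0 - Cmod z). assert (Hd : 0 < d) by (unfold d; lra).
  (* With [a = zeta - z] and [b = zeta - y] the remainder is [u (a + 2 b) (a - b)^2 / (a^3 b^2)].
     Both [|a|] and [|b|] are at most [2 r0], so [8 r0] is a generous bound for [|a + 2 b|]. *)
  eexists. apply (cderiv_cmean (fun y t => u t / ((circ r0 t - y) * (circ r0 t - y)))%C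
    (fun t => 2 * (u t / ((circ r0 t - z) * (circ r0 t - z))) / (circ r0 t - z))%C z
    (B * (8 * r0) * / (d * d * d * (d / 2 * (d / 2)))) (d / 2)).
  - lra.
  - intros y Hy. apply rcont_cauchy2. apply (near_half z y Hz Hy).
  - intros t.
    apply (rcont_div (fun t => 2 * (u t / ((circ r0 t - z) * (circ r0 t - z))))%C
      (fun t => circ r0 t - z)%C);
      [apply circ_minus_neq, Hz| |apply rcont_circ_minus].
    apply (rcont_mult (fun _ => RtoC 2)); [apply rcont_const|apply rcont_cauchy2, Hz].
  - intros y t Hy Ht. destruct (near_half z y Hz Hy) as [Hy1 Hy2].
    assert (N1 := circ_minus_neq y t Hy1). assert (N2 := circ_minus_neq z t Hz).
    specialize (Hy2 t). fold d in Hy2. assert (Hz2 := circ_minus_ge z t). fold d in Hz2.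
    set (a := (circ r0 t - z)%C) in *. set (b := (circ r0 t - y)%C) in *.
    assert (Eh : (y - z = a - b)%C) by (unfold a, b; ring).
    assert (Hab : Cmod (a + (b + b)) <= 8 * r0).
    { assert (G1 : Cmod a <= 2 * r0 /\ Cmod b <= 2 * r0).
      { unfold a, b, Cminus. split; (eapply Rle_trans; [apply Cmod_triangle|]);
          rewrite Cmod_opp, Cmod_circ by lra; lra. }
      assert (G2 := Cmod_triangle a (b + b)). assert (G3 := Cmod_triangle b b). lra. }
    replace (u t / (b * b) - u t / (a * a) - 2 * (u t / (a * a)) / a * (y - z))%C with
      (u t * (a + (b + b)) * / (a * a * a * (b * b)) * ((y - z) * (y - z)))%C
      by (rewrite Eh; field; split; assumption).
    rewrite !Cmod_mult, Cmod_inv by (repeat apply Cmult_neq_0; assumption).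
    rewrite !Cmod_mult. apply Rmult_le_compat_r.
    { apply Rmult_le_pos; apply Cmod_ge_0. }
    apply Rmult_le_compat.
    + apply Rmult_le_pos; apply Cmod_ge_0.
    + left. apply Rinv_0_lt_compat. repeat apply Rmult_lt_0_compat; lra.
    + apply Rmult_le_compat; try apply Cmod_ge_0; [apply HuB, Ht|exact Hab].
    + assert (0 <= d * d) by (apply Rmult_le_pos; lra).
      assert (0 <= d * d * d) by (apply Rmult_le_pos; lra).
      assert (0 <= d / 2 * (d / 2)) by (apply Rmult_le_pos; lra).
      apply Rinv_le_contravar; [repeat apply Rmult_lt_0_compat; lra|].
      apply Rmult_le_compat; [lra|lra| |apply Rmult_le_compat; lra].
      apply Rmult_le_compat; [lra|lra| |lra]. apply Rmult_le_compat; lra.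
Qed.
End Kernels.

Lemma circ_conj r t : (circ r t * Cconj (circ r t))%C = RtoC (r * r).
Proof.
  unfold circ, Cconj, Cmult, RtoC; simpl. f_equal; [|ring].
  transitivity (r * r * (Rsqr (sin t) + Rsqr (cos t))); [unfold Rsqr; ring|].
  rewrite sin2_cos2. ring.
Qed.

Lemma circ_neq r t : 0 < r -> circ r t <> 0.
Proof. intros H. apply Cmod_pos_neq. rewrite Cmod_circ; lra. Qed.

Lemma Cconj_neq_0 (z : C) : z <> 0 -> Cconj z <> 0.
Proof. intros H. apply Cmod_pos_neq. rewrite Cmod_conj. apply Cmod_gt_0, H. Qed.

Section Disc.
Variables (r0 : R) (z : C).
Hypothesis z_lt : Cmod z < r0.

Let r0_pos : 0 < r0.
Proof. assert (H := Cmod_ge_0 z). lra. Qed.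

(** On the circle [conj zeta = r0^2 / zeta], so the conjugate of the integrand is the boundary value
    of [F], which is differentiable on the closed disc and equals [f 0] at 0. For [f = 1] this is
    the mean 1 of [zeta / (zeta - z)]; for [f = p] it feeds the Herglotz formula. *)
Lemma cmean_conj_cauchy f :
  (forall y, Cmod y <= r0 -> cdiff f y) ->
  cmean (fun t => Cconj (f (circ r0 t)) * circ r0 t / (circ r0 t - z))%C = Cconj (f 0).
Proof.
  intros Hf.
  set (F := fun y => (f y * RtoC (r0 * r0) / (RtoC (r0 * r0) - y * Cconj z))%C).
  assert (N : forall y, Cmod y <= r0 -> (RtoC (r0 * r0) - y * Cconj z)%C <> 0).
  { intros y Hy. apply Cmod_pos_neq.
    assert (H := Cmod_triangle_minus (RtoC (r0 * r0)) (y * Cconj z)).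
    rewrite Cmod_mult, Cmod_conj, Cmod_R, Rabs_pos_eq in H by (apply Rmult_le_pos; lra).
    assert (Cmod y * Cmod z <= r0 * Cmod z) by (apply Rmult_le_compat_r; [apply Cmod_ge_0|lra]).
    assert (r0 * Cmod z < r0 * r0) by (apply Rmult_lt_compat_l; lra). lra. }
  assert (D : forall y, Cmod y <= r0 -> cdiff F y).
  { intros y Hy. apply cdiff_div; [| |apply N, Hy].
    - apply cdiff_mult; [apply Hf, Hy|apply cdiff_const].
    - apply cdiff_minus; [apply cdiff_const|].
      apply cdiff_mult; [apply cdiff_id|apply cdiff_const]. }
  assert (M : cmean (fun t => F (circ r0 t)) = f 0).
  { rewrite (mean_value F r0 0).
    - unfold F. field. replace (RtoC (r0 * r0) - 0 * Cconj z)%C with (RtoC (r0 * r0)) by ring.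
      intros K. apply RtoC_inj in K. nra.
    - exact r0_pos.
    - rewrite Cmod_0. exact r0_pos.
    - intros y Hy. apply cdiff_ccont, D, Hy.
    - intros y Hy _. apply D, Hy. }
  rewrite <- M, <- cmean_conj.
  2: { apply circ_rcont; [lra|]. intros y Hy. apply cdiff_ccont, D. lra. }
  apply cmean_ext. intros t. unfold F.
  assert (N1 := circ_minus_neq r0 r0_pos z t z_lt).
  assert (N2 := circ_neq r0 t r0_pos).
  rewrite Cdiv_conj by (apply N; rewrite Cmod_circ; lra).
  rewrite Cminus_conj, !Cmult_conj, Cconj_conj.
  replace (Cconj (RtoC (r0 * r0))) with (RtoC (r0 * r0))
    by (unfold Cconj, RtoC; simpl; f_equal; ring).
  rewrite <- (circ_conj r0 t).
  assert (N3 := Cconj_neq_0 _ N2).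
  field. split; [|exact N1].
  replace (circ r0 t * Cconj (circ r0 t) - Cconj (circ r0 t) * z)%C with
    (Cconj (circ r0 t) * (circ r0 t - z))%C by ring.
  apply Cmult_neq_0; assumption.
Qed.

(** The mean value property is applied to [G y = y (f y - f z) / (y - z)], filled in by [z f' z] at
    [z], where it is only known to be continuous. The factor [y] makes [G 0 = 0] and produces the
    weight of the Cauchy kernel; the remaining [f z] is multiplied by the mean of
    [zeta / (zeta - z)], which is 1. *)
Lemma cauchy_formula f :
  (forall y, Cmod y <= r0 -> cdiff f y) ->
  cauchy1 (fun t => f (circ r0 t) * circ r0 t)%C r0 z = f z.
Proof.
  intros Hf. destruct (Hf z ltac:(lra)) as [l Hl].
  set (G := fun y => if Ceq_dec y z then (z * l)%C else (y * (f y - f z) / (y - z))%C).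
  assert (GD : forall y, Cmod y <= r0 -> y <> z -> cdiff G y).
  { intros y Hy N. assert (N' := Cminus_eq_contra _ _ N).
    destruct (cdiff_div (fun y => y * (f y - f z))%C (fun y => y - z)%C y) as [m Hm].
    - apply cdiff_mult; [apply cdiff_id|].
      apply cdiff_minus; [apply Hf, Hy|apply cdiff_const].
    - apply cdiff_minus; [apply cdiff_id|apply cdiff_const].
    - exact N'.
    - exists m. revert Hm. apply cderiv_ext_near with (Cmod (y - z)).
      + apply Cmod_gt_0, N'.
      + intros w Hw. unfold G. destruct (Ceq_dec w z) as [->|_]; [|reflexivity].
        rewrite Cmod_minus_sym in Hw. lra. }
  assert (GC : ccont G z).
  { intros eps He. assert (Pz := Cmod_ge_0 z).
    assert (He1 : 0 < eps / (2 * (1 + Cmod z))) by (apply Rdiv_lt_0_compat; lra).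
    destruct (proj1 (cderiv_eps _ _ _) Hl _ He1) as [d1 [Hd1 K1]].
    destruct (cdiff_ccont f z ltac:(eexists; exact Hl) (eps / 2) ltac:(lra)) as [d2 [Hd2 K2]].
    exists (Rmin d1 d2). split; [apply Rmin_case; lra|]. intros y Hy. unfold G.
    destruct (Ceq_dec z z) as [_|N]; [|congruence].
    destruct (Ceq_dec y z) as [_|N].
    { replace (z * l - z * l)%C with (RtoC 0) by ring. rewrite Cmod_0. lra. }
    assert (N' := Cminus_eq_contra _ _ N). assert (P := proj1 (Cmod_gt_0 _) N').
    specialize (K1 y ltac:(eapply Rlt_le_trans; [exact Hy|apply Rmin_l])).
    specialize (K2 y ltac:(eapply Rlt_le_trans; [exact Hy|apply Rmin_r])).
    replace (y * (f y - f z) / (y - z) - z * l)%C with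
      ((f y - f z) + z * ((f y - f z - l * (y - z)) / (y - z)))%C by (field; exact N').
    eapply Rle_lt_trans; [apply Cmod_triangle|]. rewrite Cmod_mult, Cmod_div by exact N'.
    assert (Q : Cmod (f y - f z - l * (y - z)) / Cmod (y - z) <= eps / (2 * (1 + Cmod z))).
    { apply Rmult_le_reg_r with (Cmod (y - z)); [exact P|].
      unfold Rdiv at 1. rewrite Rmult_assoc, Rinv_l, Rmult_1_r by lra. exact K1. }
    assert (Cmod z * (Cmod (f y - f z - l * (y - z)) / Cmod (y - z))
      <= (1 + Cmod z) * (eps / (2 * (1 + Cmod z)))).
    { apply Rmult_le_compat; [lra| |lra|exact Q].
      apply Rmult_le_pos; [apply Cmod_ge_0|left; apply Rinv_0_lt_compat, P]. }
    replace ((1 + Cmod z) * (eps / (2 * (1 + Cmod z)))) with (eps / 2) in * by (field; lra).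
    lra. }
  assert (GC' : forall y, Cmod y <= r0 -> ccont G y).
  { intros y Hy. destruct (Ceq_dec y z) as [->|N]; [exact GC|].
    apply cdiff_ccont, GD; assumption. }
  assert (G0 : G 0 = 0).
  { unfold G. destruct (Ceq_dec 0 z) as [<-|N]; unfold Cdiv; ring. }
  assert (M := mean_value G r0 z r0_pos z_lt GC' GD). rewrite G0 in M.
  assert (K := cmean_conj_cauchy (fun _ => 1) (fun y _ => cdiff_const 1 y)).
  simpl in K.
  assert (c1 : Cconj 1 = 1) by (unfold Cconj, RtoC; simpl; f_equal; ring).
  rewrite c1 in K.
  assert (RG : forall t, rcont (fun s => G (circ r0 s)) t)
    by (apply circ_rcont; [lra|intros y Hy; apply GC'; lra]).
  assert (RK : forall t, rcont (fun s => 1 * circ r0 s / (circ r0 s - z))%C t).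
  { intros t. apply (rcont_cauchy1 (fun s => 1 * circ r0 s)%C r0); [|exact r0_pos|exact z_lt].
    intros s. apply (rcont_mult (fun _ => RtoC 1) (circ r0)); [apply rcont_const|apply rcont_circ]. }
  transitivity (cmean (fun t => G (circ r0 t) + f z * (1 * circ r0 t / (circ r0 t - z)))%C).
  - apply cmean_ext. intros t. unfold G.
    assert (N1 := circ_minus_neq r0 r0_pos z t z_lt).
    destruct (Ceq_dec (circ r0 t) z) as [E|_].
    + exfalso. apply N1. rewrite E. ring.
    + field. exact N1.
  - rewrite cmean_plus, cmean_scal, M.
    + change (fun t => 1 * circ r0 t / (circ r0 t - z))%C with
        (fun t => 1 * circ r0 t / (circ r0 t - z))%C in K.
      rewrite K. ring.
    + exact RK.
    + exact RG.
    + intros t. apply (rcont_mult (fun _ => f z)); [apply rcont_const|apply RK].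
Qed.
End Disc.

(** * Functions with positive real part *)

Lemma circ_weight_rcont f r :
  0 < r -> (forall y, Cmod y <= r -> cdiff f y) ->
  forall t, rcont (fun s => f (circ r s) * circ r s)%C t.
Proof.
  intros Hr Hf t. apply (rcont_mult (fun s => f (circ r s)) (circ r)); [|apply rcont_circ].
  apply circ_rcont; [lra|]. intros y Hy. apply cdiff_ccont, Hf. lra.
Qed.

Lemma analytic_cdiff f z : analytic_D f -> Cmod z < 1 -> cdiff f z.
Proof. intros H Hz. exact (H z Hz). Qed.

Lemma cderiv_C_derive f z : cdiff f z -> cderiv f z (C_derive f z).
Proof. intros [l Hl]. rewrite (is_C_derive_unique f z l Hl). exact Hl. Qed.

(** Near [z] the function equals [cauchy1] of its boundary data, so its derivative equals [cauchy2],
    which is differentiable. This is what makes [z f' / f] an analytic function. *)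
Lemma analytic_C_derive f : analytic_D f -> analytic_D (C_derive f).
Proof.
  intros Hf z Hz. unfold inD in Hz. assert (Pz := Cmod_ge_0 z).
  set (r := (1 + Cmod z) / 2).
  assert (Hr : 0 < r) by (unfold r; lra). assert (Hzr : Cmod z < r) by (unfold r; lra).
  assert (Hr1 : r < 1) by (unfold r; lra).
  assert (Df : forall y, Cmod y <= r -> cdiff f y)
    by (intros y Hy; apply analytic_cdiff; [exact Hf|lra]).
  set (u := fun t => (f (circ r t) * circ r t)%C).
  assert (Hu : forall t, rcont u t) by (apply circ_weight_rcont; assumption).
  destruct (cdiff_cauchy2 u r Hu Hr z Hzr) as [l Hl]. exists l.
  revert Hl. apply cderiv_ext_near with (r - Cmod z); [lra|]. intros y Hy.
  assert (Hyr : Cmod y < r) by (assert (T := Cmod_triangle_minus y z); lra).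
  symmetry. apply is_C_derive_unique.
  refine (cderiv_ext_near _ _ _ _ (r - Cmod y) _ _ (cderiv_cauchy1 u r Hu Hr y Hyr)); [lra|].
  intros x Hx. apply cauchy_formula; [|exact Df].
  assert (T := Cmod_triangle_minus x y). lra.
Qed.

(** Only the origin is delicate. Writing [zeta / (zeta - y) = 1 + y / (zeta - y)] in Cauchy's
    formula and using that the mean of [f] is [f 0 = 0] gives [f y = y g y] near 0, where [g] is the
    Cauchy transform of the unweighted data. *)
Lemma factor_z f :
  classA f -> exists F, analytic_D F /\ F 0 = 1 /\ forall z, f z = (z * F z)%C.
Proof.
  intros [Hf [f0 f1]].
  set (F := fun z => if Ceq_dec z 0 then RtoC 1 else (f z / z)%C).
  assert (Fz : forall z, f z = (z * F z)%C).
  { intros z. unfold F. destruct (Ceq_dec z 0) as [->|N].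
    - rewrite f0. ring.
    - field. exact N. }
  assert (F0 : F 0 = 1) by (unfold F; destruct (Ceq_dec 0 0); congruence).
  exists F. split; [|split; [exact F0|exact Fz]].
  intros z Hz. destruct (Ceq_dec z 0) as [->|N].
  - set (r := / 2). assert (Hr : 0 < r) by (unfold r; lra).
    assert (Df : forall y, Cmod y <= r -> cdiff f y)
      by (intros y Hy; apply analytic_cdiff; [exact Hf|unfold r in Hy; lra]).
    set (u := fun t => f (circ r t)).
    assert (Hu : forall t, rcont u t).
    { apply circ_rcont; [lra|]. intros y Hy. apply cdiff_ccont, Df. lra. }
    set (g := cauchy1 u r).
    assert (Z0 : Cmod 0 < r) by (rewrite Cmod_0; exact Hr).
    assert (Hg := cderiv_cauchy1 u r Hu Hr 0 Z0). fold g in Hg.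
    assert (gf : forall y, Cmod y < r -> f y = (y * g y)%C).
    { intros y Hy. unfold g.
      rewrite <- (cauchy_formula r y Hy f Df). unfold cauchy1.
      transitivity (cmean u + y * cmean (fun t => u t / (circ r t - y)))%C.
      - rewrite <- cmean_scal, <- cmean_plus.
        + apply cmean_ext. intros t. unfold u. field. apply circ_minus_neq; assumption.
        + exact Hu.
        + intros t. apply (rcont_mult (fun _ => y)); [apply rcont_const|].
          apply rcont_cauchy1; assumption.
        + intros t. apply rcont_cauchy1; assumption.
      - unfold u at 1. rewrite (mean_value f r 0 Hr Z0).
        + rewrite f0. ring.
        + intros x Hx. apply cdiff_ccont, Df, Hx.
        + intros x Hx _. apply Df, Hx. }
    (* The product rule at 0 gives [g 0] as the derivative of [y g y = f y], which is normalised to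
       1. *)
    assert (g0 : g 0 = 1).
    { apply (cderiv_unique f 0); [|exact f1].
      apply cderiv_ext_near with (fun y => y * g y)%C r; [exact Hr| |].
      - intros y Hy. symmetry. apply gf. replace y with (y - 0)%C by ring. exact Hy.
      - eapply cderiv_eq; [|apply cderiv_mult; [apply cderiv_id|exact Hg]]. cbv beta. ring. }
    exists (cauchy2 u r 0). revert Hg. apply cderiv_ext_near with r; [exact Hr|].
    intros y Hy. replace (y - 0)%C with y in Hy by ring. unfold F.
    destruct (Ceq_dec y 0) as [->|N]; [exact g0|]. rewrite (gf y Hy). field. exact N.
  - destruct (cdiff_div f (fun y => y) z (Hf z Hz) (cdiff_id z) N) as [l Hl].
    exists l. revert Hl. apply cderiv_ext_near with (Cmod z); [apply Cmod_gt_0, N|].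
    intros y Hy. unfold F. destruct (Ceq_dec y 0) as [->|_]; [|reflexivity].
    replace (0 - z)%C with (- z)%C in Hy by ring. rewrite Cmod_opp in Hy. lra.
Qed.

Definition rmean (v : R -> R) : R := / (2 * PI) * RInt v 0 (2 * PI).

Lemma Re_cmean u : Re (cmean u) = rmean (fun t => Re (u t)).
Proof. unfold cmean, rmean. rewrite re_scal_l. reflexivity. Qed.

Lemma rmean_scal c v : (forall t, continuity_pt v t) ->
  rmean (fun t => c * v t) = c * rmean v.
Proof.
  intros Hv. unfold rmean. assert (P := PI2_pos).
  assert (E : ex_RInt v 0 (2 * PI)).
  { apply (ex_RInt_continuous (V := R_CompleteNormedModule)). intros t _.
    apply continuity_pt_filterlim, Hv. }
  replace (RInt (fun t => c * v t) 0 (2 * PI)) with (c * RInt v 0 (2 * PI)); [ring|].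
  symmetry. exact (RInt_scal v _ _ c E).
Qed.

Lemma rmean_ext u v : (forall t, u t = v t) -> rmean u = rmean v.
Proof. intros H. unfold rmean. f_equal. apply RInt_ext. intros t _. apply H. Qed.

Lemma cmean_norm_le u v :
  (forall t, rcont u t) -> (forall t, continuity_pt v t) ->
  (forall t, Cmod (u t) <= v t) -> Cmod (cmean u) <= rmean v.
Proof.
  intros Hu Hv H. assert (P := PI2_pos). unfold cmean, rmean.
  rewrite Cmod_mult, Cmod_R, Rabs_pos_eq by (left; apply Rinv_0_lt_compat, P).
  apply Rmult_le_compat_l; [left; apply Rinv_0_lt_compat, P|].
  apply cint_norm_le; [lra| | |auto].
  - apply rcont_integrable; [lra|auto].
  - apply (ex_RInt_continuous (V := R_CompleteNormedModule)). intros t _.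
    apply continuity_pt_filterlim, Hv.
Qed.

Section Herglotz.
Variables (p : C -> C).
Hypothesis p_an : analytic_D p.
Hypothesis p0 : p 0 = 1.
Hypothesis p_pos : forall z, inD z -> 0 < Re (p z).

Section Radius.
Variables (r0 : R) (z : C).
Hypothesis r0_lt : r0 < 1.
Hypothesis z_lt : Cmod z < r0.

Let r0_pos : 0 < r0.
Proof. assert (H := Cmod_ge_0 z). lra. Qed.

Let p_diff y : Cmod y <= r0 -> cdiff p y.
Proof. intros Hy. apply analytic_cdiff; [exact p_an|lra]. Qed.

Let P t := Re (p (circ r0 t)).

Let P_pos t : 0 < P t.
Proof. apply p_pos. unfold inD. rewrite Cmod_circ; lra. Qed.

Let p_rcont t : rcont (fun s => p (circ r0 s)) t.
Proof. apply circ_rcont; [lra|]. intros y Hy. apply cdiff_ccont, p_diff. lra. Qed.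

Let P_rcont t : rcont (fun s => RtoC (P s)) t.
Proof. apply rcont_RtoC. apply (p_rcont t). Qed.

Let u (t : R) : C := (RtoC (2 * P t) * circ r0 t)%C.

Let u_rcont t : rcont u t.
Proof.
  apply (rcont_mult (fun s => RtoC (2 * P s)) (circ r0)); [|apply rcont_circ].
  apply rcont_RtoC. apply continuity_pt_scal. apply (p_rcont t).
Qed.

(* Adding to the Cauchy formula for [p] the same integral of [conj p], which is [1]. *)
Let schwarz_formula y : Cmod y < r0 -> p y = (cauchy1 u r0 y - 1)%C.
Proof.
  intros Hy.
  assert (A := cauchy_formula r0 y Hy p p_diff).
  assert (B := cmean_conj_cauchy r0 y Hy p p_diff).
  rewrite p0 in B. replace (Cconj 1) with (RtoC 1) in B
    by (unfold Cconj, RtoC; simpl; f_equal; ring).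
  rewrite <- A, <- B. unfold cauchy1. rewrite <- cmean_minus.
  - apply cmean_ext. intros t. unfold u, P.
    rewrite RtoC_mult, re_alt. field. apply circ_minus_neq; assumption.
  - intros t. apply rcont_cauchy1; assumption.
  - intros t. apply (rcont_cauchy1 (fun s => Cconj (p (circ r0 s)) * circ r0 s)%C r0);
      [|assumption..].
    intros s. apply (rcont_mult (fun s => Cconj (p (circ r0 s))) (circ r0));
      [apply rcont_conj, p_rcont|apply rcont_circ].
Qed.

Let cderiv_schwarz : cderiv p z (cauchy2 u r0 z).
Proof.
  apply cderiv_ext_near with (fun y => cauchy1 u r0 y - 1)%C (r0 - Cmod z); [lra| |].
  - intros y Hy. symmetry. apply schwarz_formula.
    assert (T := Cmod_triangle_minus y z). lra.
  - eapply cderiv_eq; [|apply cderiv_minus; [|apply cderiv_const]].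
    2: apply cderiv_cauchy1; assumption. ring.
Qed.

(** Averaging the mean value property with its conjugate. Together with [P_pos] it makes [P] a
    probability density on the circle. *)
Let cmean_P : cmean (fun t => RtoC (P t)) = 1.
Proof.
  assert (M : cmean (fun t => p (circ r0 t)) = 1).
  { rewrite (mean_value p r0 z r0_pos z_lt); [exact p0| |].
    - intros y Hy. apply cdiff_ccont, p_diff, Hy.
    - intros y Hy _. apply p_diff, Hy. }
  replace (RtoC 1) with (/ 2 * (cmean (fun t => p (circ r0 t)) + Cconj (cmean (fun t => p (circ r0 t)))))%C.
  - rewrite <- cmean_conj, <- cmean_plus, <- cmean_scal by
      (intros t; try apply rcont_plus; try apply rcont_conj; apply p_rcont).
    apply cmean_ext. intros t. unfold P. rewrite re_alt. unfold Cdiv. ring.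
  - rewrite M. replace (Cconj 1) with (RtoC 1)
      by (unfold Cconj, RtoC; simpl; f_equal; ring).
    field.
Qed.

Let D t := Cmod (circ r0 t - z).

Let D_pos t : 0 < D t.
Proof. apply Cmod_gt_0, circ_minus_neq; assumption. Qed.

(** Replacing the 1 in [schwarz_formula] by the mean of [P] turns the kernel [2 zeta / (zeta - z)]
    into [2 zeta / (zeta - z) - 1 = (zeta + z) / (zeta - z)]. *)
Let herglotz : p z = cmean (fun t => RtoC (P t) * ((circ r0 t + z) / (circ r0 t - z)))%C.
Proof.
  rewrite schwarz_formula by exact z_lt. rewrite <- cmean_P. unfold cauchy1.
  rewrite <- cmean_minus.
  - apply cmean_ext. intros t. unfold u. rewrite RtoC_mult. field.
    apply circ_minus_neq; assumption.
  - intros t. apply rcont_cauchy1; assumption.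
  - exact P_rcont.
Qed.

Let kernel_rcont t : rcont (fun s => RtoC (P s) * ((circ r0 s + z) / (circ r0 s - z)))%C t.
Proof.
  apply (rcont_mult (fun s => RtoC (P s))
    (fun s => (circ r0 s + z) / (circ r0 s - z))%C); [apply P_rcont|].
  apply (rcont_div (fun s => circ r0 s + z)%C (fun s => circ r0 s - z)%C).
  - apply circ_minus_neq; assumption.
  - apply (rcont_plus (circ r0) (fun _ => z)); [apply rcont_circ|apply rcont_const].
  - apply rcont_circ_minus.
Qed.

(** The Poisson kernel: the real part of [(zeta + z) conj (zeta - z)] is [|zeta|^2 - |z|^2]. *)
Let Re_kernel t :
  Re (RtoC (P t) * ((circ r0 t + z) / (circ r0 t - z)))
  = (r0 * r0 - Cmod z * Cmod z) * (P t / (D t * D t)).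
Proof.
  rewrite re_scal_l. assert (HD := D_pos t). unfold D in *.
  assert (N := circ_minus_neq r0 r0_pos z t z_lt).
  assert (E : Re ((circ r0 t + z) / (circ r0 t - z)) * (Cmod (circ r0 t - z) * Cmod (circ r0 t - z))
     = r0 * r0 - Cmod z * Cmod z).
  { rewrite <- re_scal_r.
    replace (((circ r0 t + z) / (circ r0 t - z)) *
      RtoC (Cmod (circ r0 t - z) * Cmod (circ r0 t - z)))%C with
      ((circ r0 t + z) * Cconj (circ r0 t - z))%C.
    - assert (Q : forall a : C, Cmod a * Cmod a = Re a * Re a + Im a * Im a)
        by (intros a; assert (T := Cmod2_alt a); lra).
      assert (Q1 := Q (circ r0 t)). rewrite Cmod_circ in Q1 by lra.
      rewrite Q, Q1. generalize (circ r0 t). intros [a b]. destruct z as [c d]. simpl. ring.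
    - replace (RtoC (Cmod (circ r0 t - z) * Cmod (circ r0 t - z))) with
        ((circ r0 t - z) * Cconj (circ r0 t - z))%C.
      + field. exact N.
      + rewrite <- Cmod2_conj. f_equal. ring. }
  rewrite <- E. field. lra.
Qed.

(** Continuity is read off from [Re_kernel]: up to a positive constant this function is the real
    part of a kernel already known to be continuous. *)
Let PD_cont t : continuity_pt (fun s => P s / (D s * D s)) t.
Proof.
  assert (H : 0 < r0 * r0 - Cmod z * Cmod z).
  { assert (Q := Cmod_ge_0 z). nra. }
  apply continuity_pt_ext with (fun s => / (r0 * r0 - Cmod z * Cmod z)
    * Re (RtoC (P s) * ((circ r0 s + z) / (circ r0 s - z)))).
  - intros s. rewrite Re_kernel. assert (HD := D_pos s). field. lra.
  - apply continuity_pt_scal. apply (kernel_rcont t).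
Qed.

(** Differentiating the integral gives [p' z] as the mean of [2 P zeta / (zeta - z)^2], of modulus
    at most [2 r0] times the mean of [P / D^2]. By the Poisson kernel, [Re (p z)] is [r0^2 - |z|^2]
    times that same mean, which therefore drops out. *)
Lemma deriv_bound_radius l : cderiv p z l ->
  Cmod l * (r0 * r0 - Cmod z * Cmod z) <= 2 * r0 * Re (p z).
Proof.
  intros Hl. rewrite (cderiv_unique _ _ _ _ Hl cderiv_schwarz).
  rewrite herglotz, Re_cmean.
  rewrite (rmean_ext _ _ Re_kernel), (rmean_scal _ _ PD_cont).
  assert (K : Cmod (cauchy2 u r0 z) <= rmean (fun t => 2 * r0 * (P t / (D t * D t)))).
  { apply cmean_norm_le.
    - intros t. apply rcont_cauchy2; assumption.
    - intros t. apply continuity_pt_scal. apply PD_cont.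
    - intros t. assert (N := circ_minus_neq r0 r0_pos z t z_lt).
      rewrite Cmod_div by (apply Cmult_neq_0; exact N).
      unfold u. rewrite !Cmod_mult, Cmod_circ, Cmod_R by lra.
      assert (HP := P_pos t). rewrite Rabs_pos_eq by lra. unfold D. right.
      assert (HD := D_pos t). unfold D in HD. field. lra. }
  rewrite (rmean_scal _ _ PD_cont) in K.
  assert (H : 0 <= r0 * r0 - Cmod z * Cmod z) by (assert (Q := Cmod_ge_0 z); nra).
  eapply Rle_trans; [apply Rmult_le_compat_r; [exact H|exact K]|]. lra.
Qed.

(** The Herglotz kernel has modulus at most [(r0 + |z|) / (r0 - |z|)], and [P] has mean 1. *)
Lemma growth_radius : Cmod (p z) * (r0 - Cmod z) <= r0 + Cmod z.
Proof.
  assert (Q := Cmod_ge_0 z).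
  assert (K : Cmod (p z) <= rmean (fun t => (r0 + Cmod z) / (r0 - Cmod z) * P t)).
  { rewrite herglotz. apply cmean_norm_le.
    - exact kernel_rcont.
    - intros t. apply continuity_pt_scal. apply (p_rcont t).
    - intros t. assert (N := circ_minus_neq r0 r0_pos z t z_lt).
      assert (HP := P_pos t). rewrite Cmod_mult, Cmod_R, Rabs_pos_eq by lra.
      rewrite Rmult_comm. apply Rmult_le_compat_r; [lra|].
      rewrite Cmod_div by exact N.
      assert (T := Cmod_triangle (circ r0 t) z). rewrite Cmod_circ in T by lra.
      assert (S := circ_minus_ge r0 r0_pos z t).
      apply Rmult_le_compat; [apply Cmod_ge_0| |exact T|].
      + left. apply Rinv_0_lt_compat. lra.
      + apply Rinv_le_contravar; lra. }
  rewrite rmean_scal in K by (intros t; apply (p_rcont t)).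
  assert (E : rmean P = 1).
  { assert (W := f_equal Re cmean_P). rewrite Re_cmean in W. exact W. }
  rewrite E in K.
  apply Rle_trans with ((r0 + Cmod z) / (r0 - Cmod z) * 1 * (r0 - Cmod z)).
  - apply Rmult_le_compat_r; [lra|exact K].
  - right. field. lra.
Qed.
End Radius.

Lemma deriv_bound z l : inD z -> cderiv p z l ->
  Cmod l * (1 - Cmod z * Cmod z) <= 2 * Re (p z).
Proof.
  intros Hz Hl. unfold inD in Hz. assert (Q := Cmod_ge_0 z). assert (L := Cmod_ge_0 l).
  assert (Pz := p_pos z Hz).
  apply Rnot_lt_le. intros G. set (g := Cmod l * (1 - Cmod z * Cmod z) - 2 * Re (p z)).
  assert (Hg : 0 < g) by (unfold g; lra).
  (* Passing from radius 1 to [1 - e] lowers the left side by at most [2 e |l|], hence by at most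
     half of the excess [g]. The first entry keeps [|z|] below [1 - e]. *)
  set (e := Rmin ((1 - Cmod z) / 2) (g / (4 * (Cmod l + 1)))).
  assert (He : 0 < e) by (apply Rmin_case; [lra|apply Rdiv_lt_0_compat; lra]).
  assert (He1 : e <= (1 - Cmod z) / 2) by apply Rmin_l.
  assert (He2 : e <= g / (4 * (Cmod l + 1))) by apply Rmin_r.
  assert (He3 : e * (4 * (Cmod l + 1)) <= g).
  { eapply Rle_trans; [apply Rmult_le_compat_r; [lra|exact He2]|]. right. field. lra. }
  assert (B := deriv_bound_radius (1 - e) z ltac:(lra) ltac:(lra) l Hl).
  assert (2 * (1 - e) * Re (p z) <= 2 * Re (p z)) by nra.
  unfold g in *. nra.
Qed.

Lemma growth_bound z : inD z -> Cmod (p z) * (1 - Cmod z) <= 1 + Cmod z.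
Proof.
  intros Hz. unfold inD in Hz. assert (Q := Cmod_ge_0 z). assert (L := Cmod_ge_0 (p z)).
  apply Rnot_lt_le. intros G. set (g := Cmod (p z) * (1 - Cmod z) - (1 + Cmod z)).
  assert (Hg : 0 < g) by (unfold g; lra).
  set (e := Rmin ((1 - Cmod z) / 2) (g / (2 * (Cmod (p z) + 1)))).
  assert (He : 0 < e) by (apply Rmin_case; [lra|apply Rdiv_lt_0_compat; lra]).
  assert (He1 : e <= (1 - Cmod z) / 2) by apply Rmin_l.
  assert (He2 : e <= g / (2 * (Cmod (p z) + 1))) by apply Rmin_r.
  assert (He3 : e * (2 * (Cmod (p z) + 1)) <= g).
  { eapply Rle_trans; [apply Rmult_le_compat_r; [lra|exact He2]|]. right. field. lra. }
  assert (B := growth_radius (1 - e) z ltac:(lra) ltac:(lra)).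
  unfold g in *. nra.
Qed.
End Herglotz.

(** * The class [Scar] *)

(** The principal root by the half-angle formula. It is used on the right half-plane, where its real
    part is positive. *)
Definition csqrt (z : C) : C :=
  let x := sqrt ((Cmod z + Re z) / 2) in (x, Im z / (2 * x)).

Lemma csqrt_re_pos z : 0 < Re z -> 0 < Re (csqrt z).
Proof.
  intros H. apply sqrt_lt_R0. assert (K := Cmod_ge_0 z). lra.
Qed.

Lemma csqrt_sqr z : 0 < Re z -> (csqrt z * csqrt z)%C = z.
Proof.
  intros H. assert (Hx := csqrt_re_pos z H). unfold csqrt in *. simpl in Hx.
  set (x := sqrt ((Cmod z + Re z) / 2)) in *.
  assert (K := Cmod_ge_0 z). assert (M := Cmod2_alt z).
  assert (X2 : x * x = (Cmod z + Re z) / 2) by (apply sqrt_sqrt; lra).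
  destruct z as [a b]. simpl in *. unfold Cmult; simpl. f_equal.
  - assert (E : b * b = 4 * (x * x) * (x * x - a)) by (rewrite X2; lra).
    replace (b / (2 * x) * (b / (2 * x))) with (b * b / (4 * (x * x))) by (field; lra).
    rewrite E. field. lra.
  - field. lra.
Qed.

Lemma csqrt_1 : csqrt 1 = 1.
Proof.
  unfold csqrt. rewrite Cmod_1. simpl.
  replace ((1 + 1) / 2) with 1 by field. rewrite sqrt_1. unfold RtoC. f_equal. field.
Qed.

Lemma cdiff_csqrt (z : C) : 0 < Re z -> cdiff csqrt z.
Proof.
  intros H. assert (Hs := csqrt_re_pos z H). set (s := csqrt z) in *.
  assert (Ns : s <> 0).
  { intros E. rewrite E in Hs. simpl in Hs. lra. }
  assert (Ps := proj1 (Cmod_gt_0 s) Ns).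
  (* With roots [s] of [z] and [t] of [y], the remainder is [- (t - s)^2 / (2 s)], and
     [|t - s| <= |y - z| / Re s] because [|t + s| >= Re s]. *)
  exists (/ (2 * s))%C. apply cderiv_quad with (/ (2 * Cmod s * (Re s * Re s))) (Re z); [exact H|].
  intros y Hy. fold s.
  assert (Hy' : 0 < Re y).
  { assert (T := re_le_Cmod (y - z)).
    change (Re (y - z)) with (Re y - Re z) in T.
    assert (T' := Rle_abs (- (Re y - Re z))). rewrite Rabs_Ropp in T'. lra. }
  assert (Ht := csqrt_re_pos y Hy'). set (t := csqrt y) in *.
  assert (Ets : (y - z = (t - s) * (t + s))%C).
  { rewrite <- (csqrt_sqr y Hy'), <- (csqrt_sqr z H). fold s t. ring. }
  assert (Hts : Re s <= Cmod (t + s)).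
  { eapply Rle_trans; [|apply re_le_Cmod]. change (Re (t + s)) with (Re t + Re s).
    rewrite Rabs_pos_eq; lra. }
  assert (E1 : Cmod (y - z) = Cmod (t - s) * Cmod (t + s)) by (rewrite Ets; apply Cmod_mult).
  assert (D0 := Cmod_ge_0 (t - s)).
  assert (E2 : Cmod (t - s) * Re s <= Cmod (y - z))
    by (rewrite E1; apply Rmult_le_compat_l; assumption).
  replace (t - s - / (2 * s) * (y - z))%C with (- ((t - s) * (t - s) / (2 * s)))%C
    by (rewrite Ets; field; exact Ns).
  assert (N2 : (2 * s)%C <> 0).
  { apply Cmult_neq_0; [|exact Ns]. intros E. apply RtoC_inj in E. lra. }
  rewrite Cmod_opp, Cmod_div, !Cmod_mult, Cmod_R, Rabs_pos_eq by (assumption || lra).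
  assert (E3 : Cmod (t - s) * Re s * (Cmod (t - s) * Re s) <= Cmod (y - z) * Cmod (y - z)).
  { apply Rmult_le_compat; try assumption; apply Rmult_le_pos; lra. }
  replace (Cmod (t - s) * Cmod (t - s) / (2 * Cmod s)) with
    (/ (2 * Cmod s * (Re s * Re s)) * (Cmod (t - s) * Re s * (Cmod (t - s) * Re s)))
    by (field; lra).
  apply Rmult_le_compat_l; [|exact E3].
  left. apply Rinv_0_lt_compat. repeat apply Rmult_lt_0_compat; lra.
Qed.

(* [2 q - 1] lies in the disc through [0] centred at [2 a - 1], whose image under the
   square root is a lemniscate inside the unit disc around [1]. *)
Lemma sqrt_disc (u : C) (a : R) :
  0 < Re u -> 1 / 2 < a <= 3 / 2 ->
  Cmod ((u * u + 1) / 2 - a) < a - 1 / 2 -> Cmod (u - 1) < 1.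
Proof.
  intros Hu Ha H. destruct u as [x y]. simpl in Hu.
  assert (Q : forall v : C, Cmod v * Cmod v = Re v * Re v + Im v * Im v)
    by (intros v; assert (T := Cmod2_alt v); lra).
  assert (H2 : Cmod (((x, y) * (x, y) + 1) / 2 - a) * Cmod (((x, y) * (x, y) + 1) / 2 - a)
    < (a - 1 / 2) * (a - 1 / 2))
    by (apply Rmult_le_0_lt_compat; try apply Cmod_ge_0; exact H).
  rewrite Q in H2.
  replace (((x, y) * (x, y) + 1) / 2 - a)%C with
    (((x * x - y * y + 1) / 2 - a, x * y) : C) in H2.
  2: { unfold Cdiv, Cinv, Cminus, Cplus, Cmult, Copp, RtoC; simpl. f_equal; field. }
  simpl in H2. set (b := a - 1 / 2) in *.
  assert (Hb : 0 < b <= 1) by (unfold b; lra).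
  replace ((x * x - y * y + 1) / 2 - a) with ((x * x - y * y) / 2 - b) in H2
    by (unfold b; field).
  (* The disc condition reads [|u|^4 < 4 b Re (u^2)]. Since [b <= 1] and [Re (u^2) <= x^2], it
     implies [|u|^2 < 2 x], which is [|u - 1| < 1]. *)
  assert (K : (x * x + y * y) * (x * x + y * y) < 4 * b * (x * x - y * y)) by nra.
  assert (D : 0 < x * x - y * y).
  { apply Rnot_le_lt. intros N. assert (0 <= (x * x + y * y) * (x * x + y * y)) by nra. nra. }
  assert (K' : (x * x + y * y) * (x * x + y * y) < 2 * x * (2 * x)) by nra.
  assert (K2 : x * x + y * y < 2 * x).
  { apply Rnot_le_lt. intros N. assert (2 * x * (2 * x) <= (x * x + y * y) * (x * x + y * y))
      by (apply Rmult_le_compat; lra). lra. }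
  assert (Q1 := Q ((x, y) - 1)%C).
  replace ((x, y) - 1)%C with ((x - 1, y) : C) in *
    by (unfold Cminus, Cplus, Copp, RtoC; simpl; f_equal; ring).
  simpl in Q1. apply Rnot_le_lt. intros N. nra.
Qed.

Lemma phi_car_sqrt u : phi_car (u - 1) = ((u * u + 1) / 2)%C.
Proof. unfold phi_car. field. Qed.

Lemma inD_scale (r : R) z : 0 < r <= 1 -> inD z -> Cmod (r * z) < r /\ inD (r * z).
Proof.
  intros Hr Hz. unfold inD in *. rewrite Cmod_mult, Cmod_R, Rabs_pos_eq by lra.
  assert (H := Cmod_ge_0 z). split; nra.
Qed.

Lemma analytic_scale F (r : R) : 0 < r <= 1 -> analytic_D F ->
  analytic_D (fun z => F (r * z))%C.
Proof.
  intros Hr HF z Hz. apply cdiff_comp; [apply HF, inD_scale; assumption|].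
  apply cdiff_mult; [apply cdiff_const|apply cdiff_id].
Qed.

Lemma cderiv_scale F (r : R) z d :
  cderiv F (r * z) d -> cderiv (fun z => F (r * z))%C z (d * r)%C.
Proof.
  intros H. apply (cderiv_comp F (fun z => r * z)%C); [exact H|].
  eapply cderiv_eq; [|apply cderiv_mult; [apply cderiv_const|apply cderiv_id]].
  cbv beta. ring.
Qed.

Lemma classA_zmul F : analytic_D F -> F 0 = 1 -> classA (fun z => z * F z)%C.
Proof.
  intros HF F0. split; [|split].
  - intros z Hz. apply cdiff_mult; [apply cdiff_id|apply HF, Hz].
  - ring.
  - destruct (HF 0) as [d Hd]; [unfold inD; rewrite Cmod_0; lra|].
    eapply cderiv_eq; [|apply cderiv_mult; [apply cderiv_id|exact Hd]].
    cbv beta. rewrite F0. ring.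
Qed.

Lemma classA_ext f g : (forall z, f z = g z) -> classA f -> classA g.
Proof.
  intros E [A [B D]]. split; [|split].
  - intros z Hz. destruct (A z Hz) as [l Hl]. exists l.
    exact (cderiv_ext _ _ _ _ E Hl).
  - rewrite <- E. exact B.
  - exact (cderiv_ext _ _ _ _ E D).
Qed.

(** The discs lie in [Re q > 1/2], so [2 q - 1] has a principal root and [csqrt (2 q (r z) - 1) - 1]
    is the Schwarz function, an inverse branch of [phi_car] applied to [q]. Its values are bounded
    point by point, so the centre [a] may vary with [z]. *)
Lemma Scar_of_disc f F (r : R) :
  analytic_D F -> F 0 = 1 -> (forall z, inD z -> F z <> 0) ->
  (forall z, f z = z * F z)%C -> 0 < r <= 1 ->
  (forall z d, Cmod z < r -> cderiv F z d ->
     exists a, 1 / 2 < a <= 3 / 2 /\ Cmod (1 + z * d / F z - a) < a - 1 / 2) ->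
  Scar (fun z => f (r * z) / r)%C.
Proof.
  intros HF F0 FN Ef Hr H.
  assert (rN : RtoC r <> 0) by (intros E; apply RtoC_inj in E; lra).
  assert (Efr : forall z, (z * F (r * z) = f (r * z) / r)%C)
    by (intros z; rewrite Ef; field; exact rN).
  set (q := fun z => (1 + z * C_derive F z / F z)%C).
  assert (Hq : analytic_D q).
  { intros z Hz. apply cdiff_plus; [apply cdiff_const|].
    apply cdiff_div; [|exact (HF z Hz)|exact (FN z Hz)].
    apply cdiff_mult; [apply cdiff_id|apply analytic_C_derive; assumption]. }
  set (v := fun z => (2 * q (r * z) - 1)%C).
  assert (Hv : analytic_D v).
  { intros z Hz. apply cdiff_minus; [|apply cdiff_const].
    apply cdiff_mult; [apply cdiff_const|].
    apply (analytic_scale q r Hr Hq z Hz). }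
  assert (qv : forall z, q (r * z)%C = ((v z + 1) / 2)%C)
    by (intros z; unfold v; field).
  assert (Hd : forall z, inD z ->
    exists a, 1 / 2 < a <= 3 / 2 /\ Cmod ((v z + 1) / 2 - a) < a - 1 / 2).
  { intros z Hz. destruct (inD_scale r z Hr Hz) as [A B]. rewrite <- qv.
    apply (H _ _ A). apply cderiv_C_derive, HF. exact B. }
  assert (vpos : forall z, inD z -> 0 < Re (v z)).
  { intros z Hz. destruct (Hd z Hz) as [a [Ha K]].
    assert (T := re_le_Cmod ((v z + 1) / 2 - a)).
    replace (Re ((v z + 1) / 2 - a)) with ((Re (v z) + 1) / 2 - a) in T.
    - assert (T' := Rle_abs (- ((Re (v z) + 1) / 2 - a))). rewrite Rabs_Ropp in T'. lra.
    - destruct (v z) as [x y]. unfold Cdiv, Cinv, Cminus, Cplus, Cmult, Copp, RtoC; simpl.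
      field. }
  split.
  - apply (classA_ext _ _ Efr). apply (classA_zmul (fun z => F (r * z))%C).
    + apply analytic_scale; assumption.
    + rewrite Cmult_0_r. exact F0.
  - exists (fun z => csqrt (v z) - 1)%C. split; [split; [|split]|].
    + intros z Hz. apply cdiff_minus; [|apply cdiff_const].
      apply (cdiff_comp csqrt v); [apply cdiff_csqrt, vpos, Hz|apply Hv, Hz].
    + intros z Hz. destruct (Hd z Hz) as [a [Ha K]].
      apply (sqrt_disc (csqrt (v z)) a); [apply csqrt_re_pos, vpos, Hz|exact Ha|].
      rewrite csqrt_sqr by (apply vpos, Hz). exact K.
    + replace (v 0) with (RtoC 1) by (unfold v, q; rewrite Cmult_0_r, F0; field).
      rewrite csqrt_1. ring.
    + intros z Hz Nz. destruct (inD_scale r z Hr Hz) as [A B].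
      assert (FzN := FN _ B). rewrite <- Efr.
      split; [apply Cmult_neq_0; assumption|].
      exists (1 * F (r * z) + z * (C_derive F (r * z) * r))%C. split.
      * apply (cderiv_ext _ _ _ _ Efr).
        apply (cderiv_mult (fun z => z) (fun z => F (r * z))%C); [apply cderiv_id|].
        apply cderiv_scale, cderiv_C_derive, HF. exact B.
      * rewrite phi_car_sqrt, csqrt_sqr, <- qv by (apply vpos, Hz).
        unfold q. field. split; assumption.
Qed.

(* The value [1/2 = phi_car (-1)] is a boundary value of [phi_car]. *)
Lemma radius_upper_bound (Fam : (C -> C) -> Prop) f z0 d :
  Fam f -> 0 < Cmod z0 -> cderiv f z0 d -> (z0 * d / f z0 = / 2)%C ->
  is_upper_bound (radius_set Fam) (Cmod z0).
Proof.
  intros Hf Hz Hd E r [Hr H]. apply Rnot_lt_le. intros L.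
  assert (rN : RtoC r <> 0) by (intros K; apply RtoC_inj in K; lra).
  set (z := (z0 / r)%C).
  assert (Ez : (r * z = z0)%C) by (unfold z; field; exact rN).
  assert (Nz0 : z0 <> 0) by (apply Cmod_gt_0, Hz).
  assert (Nz : z <> 0).
  { intros K. apply Nz0. rewrite <- Ez, K. ring. }
  assert (Dz : inD z).
  { unfold inD, z. rewrite Cmod_div, Cmod_R, Rabs_pos_eq by (assumption || lra).
    apply Rmult_lt_reg_r with r; [lra|]. unfold Rdiv. rewrite Rmult_assoc, Rinv_l by lra. lra. }
  destruct (H f Hf) as [_ [w [[_ [wD _]] K]]].
  destruct (K z Dz Nz) as [Nf [d' [Hd' E']]]. rewrite Ez in Nf, E'.
  assert (Ed : d' = d).
  { apply (cderiv_unique (fun z => f (r * z) / r)%C z); [exact Hd'|].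
    eapply cderiv_eq; [|apply (cderiv_mult (fun z => f (r * z))%C (fun _ => / r)%C);
      [apply cderiv_scale; rewrite Ez; exact Hd|apply cderiv_const]].
    cbv beta. field. exact rN. }
  assert (fN : f z0 <> 0).
  { intros Z. apply Nf. rewrite Z. unfold Cdiv. ring. }
  assert (W : phi_car (w z) = (/ 2)%C).
  { rewrite <- E', <- E, Ed. unfold z. field. split; assumption. }
  (* [phi_car w - 1/2 = (w + 1)^2 / 2], so the value [1/2] is taken only at [w = -1], which lies
     outside the open disc. *)
  assert (W2 : ((w z + 1) * (w z + 1))%C = 0).
  { transitivity (2 * (phi_car (w z) - / 2))%C.
    - unfold phi_car. field.
    - rewrite W. ring. }
  assert (W3 : (w z + 1)%C = 0).
  { destruct (Ceq_dec (w z + 1) 0) as [Z|N]; [exact Z|].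
    exfalso. apply (Cmult_neq_0 _ _ N N W2). }
  specialize (wD z Dz). unfold inD in wD.
  replace (w z) with (- (1))%C in wD.
  - rewrite Cmod_opp, Cmod_1 in wD. lra.
  - replace (w z) with (w z + 1 - 1)%C by ring. rewrite W3. ring.
Qed.

Lemma Re_div_pos (a b : C) : b <> 0 -> 0 < Re (a * Cconj b) -> 0 < Re (a / b).
Proof.
  intros N H. assert (P := proj1 (Cmod_gt_0 b) N).
  assert (E : Re (a / b) * (Cmod b * Cmod b) = Re (a * Cconj b)).
  { rewrite <- re_scal_r. f_equal.
    replace (RtoC (Cmod b * Cmod b)) with (b * Cconj b)%C.
    - field. exact N.
    - rewrite <- Cmod2_conj. f_equal. ring. }
  rewrite <- E in H. apply Rmult_lt_reg_r with (Cmod b * Cmod b); [nra|]. lra.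
Qed.


(** * Sharp bounds for logarithmic derivatives *)

Definition k_pos (r : R) : R := 2 * r / (1 - r * r).
Definition k_disc (r : R) : R := r / (1 - r).

Lemma Re_pos_neq (z : C) : 0 < Re z -> z <> 0.
Proof. intros H ->. simpl in H. lra. Qed.

Lemma Re_le_Cmod (z : C) : Re z <= Cmod z.
Proof. eapply Rle_trans; [apply Rle_abs|apply re_le_Cmod]. Qed.

Lemma log_deriv_pos p z l :
  analytic_D p -> p 0 = 1 -> (forall z, inD z -> 0 < Re (p z)) ->
  inD z -> cderiv p z l -> Cmod (z * l / p z) <= k_pos (Cmod z).
Proof.
  intros Hp p0 pp Hz Hl. assert (B := deriv_bound p Hp p0 pp z l Hz Hl).
  assert (N := Re_pos_neq _ (pp z Hz)). assert (P := proj1 (Cmod_gt_0 _) N).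
  assert (K := Re_le_Cmod (p z)). assert (Z := Cmod_ge_0 z). unfold inD in Hz.
  rewrite Cmod_div, Cmod_mult by exact N. unfold k_pos.
  assert (D : 0 < 1 - Cmod z * Cmod z) by nra.
  apply Rmult_le_reg_r with (Cmod (p z) * (1 - Cmod z * Cmod z)); [nra|].
  replace (Cmod z * Cmod l / Cmod (p z) * (Cmod (p z) * (1 - Cmod z * Cmod z)))
    with (Cmod z * (Cmod l * (1 - Cmod z * Cmod z))) by (field; lra).
  replace (2 * Cmod z / (1 - Cmod z * Cmod z) * (Cmod (p z) * (1 - Cmod z * Cmod z)))
    with (Cmod z * (2 * Cmod (p z))) by (field; lra).
  apply Rmult_le_compat_l; lra.
Qed.

Lemma disc_neq_0 (w : C) : Cmod (w - 1) < 1 -> w <> 0.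
Proof.
  intros H ->. replace (0 - 1)%C with (- (1))%C in H by ring.
  rewrite Cmod_opp, Cmod_1 in H. lra.
Qed.

(* [w |-> 2 / w - 1] maps the disc [|w - 1| < 1] onto the right half-plane. *)
Lemma log_deriv_disc p z l :
  analytic_D p -> p 0 = 1 -> (forall z, inD z -> Cmod (p z - 1) < 1) ->
  inD z -> cderiv p z l -> Cmod (z * l / p z) <= k_disc (Cmod z).
Proof.
  intros Hp p0 pd Hz Hl.
  assert (pN : forall z, inD z -> p z <> 0) by (intros y Hy; apply disc_neq_0, pd, Hy).
  set (q := fun z => (2 / p z - 1)%C).
  assert (Hq : analytic_D q).
  { intros y Hy. apply cdiff_minus; [|apply cdiff_const].
    apply cdiff_div; [apply cdiff_const|apply Hp, Hy|apply pN, Hy]. }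
  assert (q0 : q 0 = 1) by (unfold q; rewrite p0; field).
  assert (qp : forall y, inD y -> 0 < Re (q y)).
  { intros y Hy. unfold q.
    replace (2 / p y - 1)%C with ((2 - p y) / p y)%C by (field; apply pN, Hy).
    apply Re_div_pos; [apply pN, Hy|]. specialize (pd y Hy).
    assert (T := Cmod2_alt (p y - 1)). assert (G := Cmod_ge_0 (p y - 1)).
    destruct (p y) as [a b]. simpl in *. nra. }
  assert (N := pN z Hz). assert (P := proj1 (Cmod_gt_0 _) N).
  assert (Dq : cderiv q z (- (2 * l / (p z * p z)))%C).
  { eapply cderiv_eq; [|apply cderiv_minus;
      [apply (cderiv_div (fun _ => RtoC 2) p); [apply cderiv_const|exact Hl|exact N]
      |apply cderiv_const]].
    cbv beta. field. exact N. }
  assert (B := deriv_bound q Hq q0 qp z _ Hz Dq).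
  assert (G := growth_bound q Hq q0 qp z Hz).
  assert (Z := Cmod_ge_0 z). unfold inD in Hz.
  set (m := Cmod (p z)) in *. set (r := Cmod z) in *.
  (* The number [2 / m - 1] lies between [Re (q z)] and [|q z|]: the derivative bound uses the
     former inequality, and the growth bound with the latter gives [m >= 1 - r]. *)
  assert (R1 : Re (q z) <= 2 / m - 1).
  { unfold q. change (Re (2 / p z) - 1 <= 2 / m - 1).
    assert (T := Re_le_Cmod (2 / p z)). rewrite Cmod_div, Cmod_R, Rabs_pos_eq in T by (assumption || lra).
    fold m in T. lra. }
  assert (R2 : 2 / m - 1 <= Cmod (q z)).
  { unfold q. eapply Rle_trans; [|apply Cmod_triangle_minus].
    rewrite Cmod_div, Cmod_R, Cmod_1, Rabs_pos_eq by (assumption || lra). fold m. lra. }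
  assert (m_ge : 1 - r <= m).
  { assert (T : (2 / m - 1) * (1 - r) <= 1 + r)
      by (eapply Rle_trans; [apply Rmult_le_compat_r; [lra|exact R2]|exact G]).
    assert (T2 : 2 / m * (1 - r) <= 2) by lra.
    apply Rmult_le_reg_l with (2 / m); [apply Rdiv_lt_0_compat; lra|].
    replace (2 / m * m) with 2 by (field; lra). exact T2. }
  assert (Nl : Cmod (- (2 * l / (p z * p z)))%C = 2 * Cmod l / (m * m)).
  { rewrite Cmod_opp, Cmod_div, !Cmod_mult, Cmod_R, Rabs_pos_eq
      by (lra || apply Cmult_neq_0; assumption). reflexivity. }
  rewrite Nl in B.
  assert (B2 : Cmod l * (1 - r * r) <= (2 - m) * m).
  { apply Rmult_le_reg_l with (2 / (m * m)); [apply Rdiv_lt_0_compat; nra|].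
    replace (2 / (m * m) * (Cmod l * (1 - r * r))) with (2 * Cmod l / (m * m) * (1 - r * r))
      by (field; lra).
    replace (2 / (m * m) * ((2 - m) * m)) with (2 * (2 / m - 1)) by (field; lra). lra. }
  (* From [m >= 1 - r] follows [2 - m <= 1 + r], and the factor [1 + r] of [1 - r^2] in [B2]
     cancels. *)
  assert (B3 : Cmod l * (1 - r) <= m).
  { apply Rmult_le_reg_r with (1 + r); [lra|]. nra. }
  rewrite Cmod_div, Cmod_mult by exact N. fold m r. unfold k_disc.
  apply Rmult_le_reg_r with (m * (1 - r)); [nra|].
  replace (r * Cmod l / m * (m * (1 - r))) with (r * (Cmod l * (1 - r))) by (field; lra).
  replace (r / (1 - r) * (m * (1 - r))) with (r * m) by (field; lra).
  apply Rmult_le_compat_l; lra.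
Qed.

(** * Radii for a model function *)

Lemma Cdiv_0_r (a : C) : (a / 0)%C = 0.
Proof.
  unfold Cdiv, Cinv, Cmult, RtoC; simpl. f_equal; unfold Rdiv; ring.
Qed.

(** The case [b = 0] holds by the convention [x / 0 = 0]. This lets the quotient conditions be
    transferred before the denominators are known not to vanish. *)
Lemma Cdiv_zmul (z a b : C) : z <> 0 -> (z * a / (z * b) = a / b)%C.
Proof.
  intros Hz. destruct (Ceq_dec b 0) as [->|N].
  - rewrite Cmult_0_r, !Cdiv_0_r. reflexivity.
  - field. split; assumption.
Qed.

(** The class conditions leave out the origin; after division by [z] the quotient is 1 there, so
    positivity holds on the whole disc. *)
Lemma re_quot_factor (f g F G : C -> C) :
  re_quot_pos f g -> F 0 = 1 -> G 0 = 1 ->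
  (forall z, inD z -> f z = z * F z)%C -> (forall z, inD z -> g z = z * G z)%C ->
  forall z, inD z -> 0 < Re (F z / G z).
Proof.
  intros H F0 G0 Ef Eg z Hz. destruct (Ceq_dec z 0) as [->|N].
  - rewrite F0, G0. replace (1 / 1)%C with (RtoC 1) by field. simpl. lra.
  - specialize (H z Hz N). rewrite Ef, Eg, Cdiv_zmul in H by assumption. exact H.
Qed.

Lemma div_Re_pos_neq (a b : C) : 0 < Re (a / b) -> a <> 0 /\ b <> 0.
Proof.
  intros H. split; intros ->; apply Re_pos_neq in H; apply H.
  - unfold Cdiv. ring.
  - apply Cdiv_0_r.
Qed.

Lemma cderiv_ext_D f g z l :
  (forall y, inD y -> f y = g y) -> inD z -> cderiv f z l -> cderiv g z l.
Proof.
  intros E Hz. apply cderiv_ext_near with (1 - Cmod z); [unfold inD in Hz; lra|].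
  intros y Hy. apply E. unfold inD. assert (T := Cmod_triangle_minus y z). lra.
Qed.

Definition ratio_bound (p : C -> C) (k : R -> R) :=
  forall z l, inD z -> cderiv p z l -> Cmod (z * l / p z) <= k (Cmod z).

Section Model.
Variables (chi X dX : C -> C) (A B : R -> R) (c : C).
Hypothesis chi_X : forall z, inD z -> chi z = (z * X z)%C.
Hypothesis X_deriv : forall z, inD z -> cderiv X z (dX z).
Hypothesis X_0 : X 0 = 1.
Hypothesis X_neq : forall z, inD z -> X z <> 0.
Hypothesis X_disc : forall z, inD z ->
  Cmod (1 + z * dX z / X z - A (Cmod z)) <= B (Cmod z).
Hypothesis c_unit : Cmod c = 1.
(** The point [- r conj c], where [c z = - r], is where the model term reaches the left end of its
    disc. The same [c] rotates the extremal factors below, so that all of them are extremal there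
    together. *)
Hypothesis X_extremal : forall r, 0 < r < 1 ->
  (1 + - r * Cconj c * dX (- r * Cconj c) / X (- r * Cconj c))%C = RtoC (A r - B r).

Let X_an : analytic_D X.
Proof. intros z Hz. eexists. apply X_deriv, Hz. Qed.

(** The disc for [z f' / f] has centre [A r] and radius [B r + k r]. At [rad] its left end touches
    [1/2]; below [rad] it stays strictly to the right, and the centre is in the range where such a
    disc lies in the image of [phi_car]. *)
Definition admissible (k : R -> R) (rad : R) :=
  0 < rad < 1 /\ A rad - B rad - k rad = 1 / 2 /\
  forall r, 0 <= r < rad -> 1 / 2 < A r <= 3 / 2 /\ B r + k r < A r - 1 / 2.

Lemma Scar_product (f F p1 p2 : C -> C) k1 k2 rad :
  analytic_D F -> F 0 = 1 -> (forall z, f z = z * F z)%C ->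
  analytic_D p1 -> analytic_D p2 ->
  (forall z, inD z -> p1 z <> 0) -> (forall z, inD z -> p2 z <> 0) ->
  (forall z, inD z -> F z = p1 z * p2 z * X z)%C ->
  ratio_bound p1 k1 -> ratio_bound p2 k2 ->
  admissible (fun r => k1 r + k2 r) rad ->
  Scar (fun z => f (rad * z) / rad)%C.
Proof.
  intros HF F0 Ef H1 H2 N1 N2 EF K1 K2 [Hrad [_ Hm]].
  assert (FN : forall z, inD z -> F z <> 0).
  { intros z Hz. rewrite (EF z Hz). repeat apply Cmult_neq_0; auto. }
  apply (Scar_of_disc f F); try assumption; [lra|].
  intros z d Hz Hd. assert (Dz : inD z) by (unfold inD; lra).
  destruct (Hm (Cmod z) (conj (Cmod_ge_0 z) Hz)) as [Ha Hb].
  exists (A (Cmod z)). split; [exact Ha|].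
  destruct (H1 z Dz) as [l1 L1]. destruct (H2 z Dz) as [l2 L2].
  assert (Ed : d = ((l1 * p2 z + p1 z * l2) * X z + p1 z * p2 z * dX z)%C).
  { apply (cderiv_unique F z); [exact Hd|].
    apply (cderiv_ext_D (fun z => p1 z * p2 z * X z)%C);
      [intros y Hy; symmetry; apply EF, Hy|exact Dz|].
    apply (cderiv_mult (fun z => p1 z * p2 z)%C); [|apply X_deriv, Dz].
    apply cderiv_mult; assumption. }
  assert (E : (1 + z * d / F z - A (Cmod z) =
    (1 + z * dX z / X z - A (Cmod z)) + (z * l1 / p1 z + z * l2 / p2 z))%C).
  { rewrite Ed, EF by exact Dz. field. repeat split; auto. }
  rewrite E. eapply Rle_lt_trans; [apply Cmod_triangle|].
  assert (T := Cmod_triangle (z * l1 / p1 z) (z * l2 / p2 z)).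
  specialize (K1 z l1 Dz L1). specialize (K2 z l2 Dz L2). specialize (X_disc z Dz). lra.
Qed.

Lemma quot_analytic (F G : C -> C) : analytic_D F -> analytic_D G -> (forall z, inD z -> G z <> 0) ->
  analytic_D (fun z => F z / G z)%C.
Proof.
  intros HF HG N z Hz. apply cdiff_div; [exact (HF z Hz)|exact (HG z Hz)|exact (N z Hz)].
Qed.

Lemma quot_0 (F G : C -> C) : F 0 = 1 -> G 0 = 1 -> (F 0 / G 0)%C = 1.
Proof. intros -> ->. field. Qed.

Lemma radius_F1_mem rad : admissible (fun r => k_pos r + k_pos r) rad ->
  radius_set (F1 chi) rad.
Proof.
  intros Hr. split; [destruct Hr; lra|]. intros f [Hf [g [Hg [Hgc Hfg]]]].
  destruct (factor_z f Hf) as [F [HF [F0 Ef]]].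
  destruct (factor_z g Hg) as [G [HG [G0 Eg]]].
  assert (P1 := re_quot_factor g chi G X Hgc G0 X_0 (fun z _ => Eg z) chi_X).
  assert (P2 := re_quot_factor f g F G Hfg F0 G0 (fun z _ => Ef z) (fun z _ => Eg z)).
  assert (GN : forall z, inD z -> G z <> 0)
    by (intros z Hz; exact (proj1 (div_Re_pos_neq _ _ (P1 z Hz)))).
  apply (Scar_product f F (fun z => G z / X z)%C (fun z => F z / G z)%C k_pos k_pos);
    try assumption.
  - apply quot_analytic; assumption.
  - apply quot_analytic; assumption.
  - intros z Hz. apply Re_pos_neq, P1, Hz.
  - intros z Hz. apply Re_pos_neq, P2, Hz.
  - intros z Hz. field. split; auto.
  - intros z l. apply (log_deriv_pos (fun z => G z / X z)%C).
    + apply quot_analytic; assumption.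
    + apply quot_0; assumption.
    + exact P1.
  - intros z l. apply (log_deriv_pos (fun z => F z / G z)%C).
    + apply quot_analytic; assumption.
    + apply quot_0; assumption.
    + exact P2.
Qed.

Lemma radius_F2_mem rad : admissible (fun r => k_pos r + k_disc r) rad ->
  radius_set (F2 chi) rad.
Proof.
  intros Hr. split; [destruct Hr; lra|]. intros f [Hf [g [Hg [Hgc Hfg]]]].
  destruct (factor_z f Hf) as [F [HF [F0 Ef]]].
  destruct (factor_z g Hg) as [G [HG [G0 Eg]]].
  assert (P1 := re_quot_factor g chi G X Hgc G0 X_0 (fun z _ => Eg z) chi_X).
  assert (GN : forall z, inD z -> G z <> 0)
    by (intros z Hz; exact (proj1 (div_Re_pos_neq _ _ (P1 z Hz)))).
  assert (P2 : forall z, inD z -> Cmod (F z / G z - 1) < 1).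
  { intros z Hz. destruct (Ceq_dec z 0) as [->|N].
    - rewrite quot_0 by assumption. replace (1 - 1)%C with (RtoC 0) by ring.
      rewrite Cmod_0. lra.
    - specialize (Hfg z Hz N). rewrite Ef, Eg, Cdiv_zmul in Hfg by exact N. exact Hfg. }
  apply (Scar_product f F (fun z => G z / X z)%C (fun z => F z / G z)%C k_pos k_disc);
    try assumption.
  - apply quot_analytic; assumption.
  - apply quot_analytic; assumption.
  - intros z Hz. apply Re_pos_neq, P1, Hz.
  - intros z Hz. apply disc_neq_0, P2, Hz.
  - intros z Hz. field. split; auto.
  - intros z l. apply (log_deriv_pos (fun z => G z / X z)%C).
    + apply quot_analytic; assumption.
    + apply quot_0; assumption.
    + exact P1.
  - intros z l. apply (log_deriv_disc (fun z => F z / G z)%C).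
    + apply quot_analytic; assumption.
    + apply quot_0; assumption.
    + exact P2.
Qed.

Lemma radius_F3_mem rad : admissible (fun r => k_pos r + 0) rad ->
  radius_set (F3 chi) rad.
Proof.
  intros Hr. split; [destruct Hr; lra|]. intros f [Hf Hfc].
  destruct (factor_z f Hf) as [F [HF [F0 Ef]]].
  assert (P1 := re_quot_factor f chi F X Hfc F0 X_0 (fun z _ => Ef z) chi_X).
  apply (Scar_product f F (fun z => F z / X z)%C (fun _ => 1) k_pos (fun _ => 0));
    try assumption.
  - apply quot_analytic; assumption.
  - intros z Hz. apply cdiff_const.
  - intros z Hz. apply Re_pos_neq, P1, Hz.
  - intros z Hz. apply C1_nz.
  - intros z Hz. field. auto.
  - intros z l. apply (log_deriv_pos (fun z => F z / X z)%C).
    + apply quot_analytic; assumption.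
    + apply quot_0; assumption.
    + exact P1.
  - intros z l Hz Hl. rewrite (cderiv_unique _ _ _ _ Hl (cderiv_const 1 z)).
    rewrite Cmult_0_r. unfold Cdiv. rewrite Cmult_0_l, Cmod_0. lra.
Qed.

(** The rotated half-plane map, extremal for [Re p > 0]; the next one, [1 + c z], is extremal for
    [|p - 1| < 1]. At [c z = - r] their logarithmic derivatives times [z] are exactly [- k_pos r]
    and [- k_disc r]. *)
Let p1 (z : C) : C := ((1 + c * z) / (1 - c * z))%C.
Let p2 (z : C) : C := (1 + c * z)%C.

Let cz_lt z : inD z -> Cmod (c * z) < 1.
Proof. intros Hz. rewrite Cmod_mult, c_unit, Rmult_1_l. exact Hz. Qed.

Lemma one_minus_neq_0 (w : C) : Cmod w < 1 -> (1 - w)%C <> 0.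
Proof.
  intros H E. assert (T := Cmod_triangle_minus 1 w). rewrite E, Cmod_0, Cmod_1 in T. lra.
Qed.

Lemma one_plus_neq_0 (w : C) : Cmod w < 1 -> (1 + w)%C <> 0.
Proof.
  intros H. replace (1 + w)%C with (1 - - w)%C by ring. apply one_minus_neq_0.
  rewrite Cmod_opp. exact H.
Qed.

Let p2_deriv z : cderiv p2 z c.
Proof.
  eapply cderiv_eq; [|apply cderiv_plus;
    [apply cderiv_const|apply cderiv_mult; [apply cderiv_const|apply cderiv_id]]].
  cbv beta. ring.
Qed.

Let p1_deriv z : inD z -> cderiv p1 z (2 * c / ((1 - c * z) * (1 - c * z)))%C.
Proof.
  intros Hz. assert (N := one_minus_neq_0 _ (cz_lt z Hz)).
  eapply cderiv_eq; [|apply (cderiv_div p2 (fun z => 1 - c * z)%C);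
    [apply p2_deriv
    |apply cderiv_minus;
      [apply cderiv_const|apply cderiv_mult; [apply cderiv_const|apply cderiv_id]]
    |exact N]].
  cbv beta. unfold p2. field. exact N.
Qed.

Let p1_pos z : inD z -> 0 < Re (p1 z).
Proof.
  intros Hz. assert (H := cz_lt z Hz). apply Re_div_pos; [apply one_minus_neq_0, H|].
  assert (T := Cmod2_alt (c * z)). assert (G := Cmod_ge_0 (c * z)).
  destruct (c * z)%C as [a b]. simpl in *. nra.
Qed.

Let p1_an : analytic_D p1.
Proof. intros z Hz. eexists. apply p1_deriv, Hz. Qed.

Let p2_an : analytic_D p2.
Proof. intros z Hz. eexists. apply p2_deriv. Qed.

Let mult_an F G : analytic_D F -> analytic_D G -> analytic_D (fun z => F z * G z)%C.
Proof. intros HF HG z Hz. apply cdiff_mult; [exact (HF z Hz)|exact (HG z Hz)]. Qed.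

Let p1_0 : p1 0 = 1.
Proof. unfold p1. rewrite Cmult_0_r. field. Qed.

Let p2_0 : p2 0 = 1.
Proof. unfold p2. ring. Qed.

Let extremal (q : C -> C) (z : C) : C := (z * (X z * q z))%C.

Let extremal_A q : analytic_D q -> q 0 = 1 -> classA (extremal q).
Proof.
  intros Hq q0. apply classA_zmul; [apply mult_an; assumption|].
  rewrite X_0, q0. ring.
Qed.

Let extremal_chi q : (forall z, inD z -> 0 < Re (q z)) -> re_quot_pos (extremal q) chi.
Proof.
  intros H z Hz N. unfold extremal. rewrite chi_X, Cdiv_zmul by assumption.
  replace (X z * q z / X z)%C with (q z) by (field; auto). auto.
Qed.

Let z_at (r : R) : C := (- r * Cconj c)%C.

Let Cmod_z_at r : 0 < r -> Cmod (z_at r) = r.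
Proof.
  intros Hr. unfold z_at. rewrite Cmod_mult, Cmod_opp, Cmod_conj, c_unit, Cmod_R.
  rewrite Rabs_pos_eq; lra.
Qed.

Let c_z_at r : (c * z_at r)%C = RtoC (- r).
Proof.
  unfold z_at. replace (c * (- r * Cconj c))%C with (- r * (c * Cconj c))%C by ring.
  rewrite <- Cmod2_conj, c_unit, RtoC_opp. replace (1 ^ 2) with 1 by ring. ring.
Qed.

(** At [z_at rad] the model contributes [A - B] and [q] contributes [- k]; their sum is the
    forbidden value [1/2] by the equation in [admissible]. *)
Lemma extremal_upper_bound Fam q dq k rad :
  Fam (extremal q) -> admissible k rad -> cderiv q (z_at rad) dq -> q (z_at rad) <> 0 ->
  (z_at rad * dq / q (z_at rad))%C = RtoC (- k rad) ->
  is_upper_bound (radius_set Fam) rad.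
Proof.
  intros HF [Hr [Hk _]] Hq Nq Eq. set (z := z_at rad) in *.
  assert (Mz : Cmod z = rad) by (apply Cmod_z_at; lra).
  assert (Dz : inD z) by (unfold inD; lra).
  assert (Nz : z <> 0) by (apply Cmod_gt_0; lra).
  rewrite <- Mz.
  apply (radius_upper_bound Fam (extremal q) z
    (1 * (X z * q z) + z * (dX z * q z + X z * dq))%C).
  - exact HF.
  - lra.
  - apply (cderiv_mult (fun z => z) (fun z => X z * q z)%C); [apply cderiv_id|].
    apply cderiv_mult; [apply X_deriv, Dz|exact Hq].
  - assert (XN := X_neq z Dz).
    transitivity ((1 + z * dX z / X z) + z * dq / q z)%C.
    + unfold extremal. field. repeat split; assumption.
    + assert (T := X_extremal rad Hr). fold (z_at rad) in T. fold z in T.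
      rewrite T, Eq, <- RtoC_plus.
      replace (A rad - B rad + - k rad) with (/ 2) by lra.
      rewrite RtoC_inv by lra. reflexivity.
Qed.

Let p1_ratio r : 0 < r < 1 ->
  (z_at r * (2 * c / ((1 - c * z_at r) * (1 - c * z_at r))) / p1 (z_at r))%C = RtoC (- k_pos r).
Proof.
  intros Hr. assert (N : forall s : R, s <> 0 -> RtoC s <> 0)
    by (intros s Hs E; apply RtoC_inj in E; auto).
  unfold p1, k_pos.
  transitivity (2 * (c * z_at r) / ((1 - c * z_at r) * (1 + c * z_at r)))%C.
  - assert (Dz : inD (z_at r)) by (unfold inD; rewrite Cmod_z_at; lra).
    field. split; [apply one_plus_neq_0|apply one_minus_neq_0]; apply cz_lt, Dz.
  - rewrite c_z_at. rewrite <- RtoC_minus, <- RtoC_plus, <- !RtoC_mult, <- RtoC_div by nra.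
    f_equal. field. nra.
Qed.

Let p2_ratio r : 0 < r < 1 -> (z_at r * c / p2 (z_at r))%C = RtoC (- k_disc r).
Proof.
  intros Hr. unfold p2, k_disc. rewrite (Cmult_comm _ c), c_z_at.
  rewrite <- RtoC_plus, <- RtoC_div by lra. f_equal. field. lra.
Qed.

Let z_at_D r : 0 < r < 1 -> inD (z_at r).
Proof. intros Hr. unfold inD. rewrite Cmod_z_at; lra. Qed.

Lemma is_lub_of_mem (E : R -> Prop) r : E r -> is_upper_bound E r -> is_lub E r.
Proof. intros H U. split; [exact U|]. intros b Hb. apply Hb, H. Qed.

Let extremal_quot q z : inD z -> z <> 0 ->
  (extremal (fun z => p1 z * q z) z / extremal p1 z)%C = q z.
Proof.
  intros Hz N. assert (N1 := Re_pos_neq _ (p1_pos z Hz)). assert (NX := X_neq z Hz).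
  unfold extremal. field. repeat split; assumption.
Qed.

Lemma radius_F1 rad : admissible (fun r => k_pos r + k_pos r) rad -> Scar_radius (F1 chi) rad.
Proof.
  intros H. apply is_lub_of_mem; [apply radius_F1_mem, H|].
  destruct H as [Hr H']. assert (Dz := z_at_D rad Hr).
  assert (N := Re_pos_neq _ (p1_pos _ Dz)).
  (* The witness is [f = z X p1^2] with [g = z X p1], so both quotients in the definition of the
     class equal [p1]. *)
  eapply (extremal_upper_bound _ (fun z => p1 z * p1 z)%C).
  2: exact (conj Hr H').
  2: apply cderiv_mult; apply p1_deriv, Dz.
  - split; [apply extremal_A; [apply mult_an; exact p1_an|rewrite p1_0; ring]|].
    exists (extremal p1). split; [apply extremal_A; assumption|].
    split; [apply extremal_chi, p1_pos|]. intros z Hz Nz.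
    rewrite extremal_quot by assumption. apply p1_pos, Hz.
  - apply Cmult_neq_0; exact N.
  - cbv beta. rewrite Ropp_plus_distr, RtoC_plus, <- p1_ratio by exact Hr.
    field. split; [apply one_minus_neq_0, cz_lt, Dz|exact N].
Qed.

Lemma radius_F2 rad : admissible (fun r => k_pos r + k_disc r) rad -> Scar_radius (F2 chi) rad.
Proof.
  intros H. apply is_lub_of_mem; [apply radius_F2_mem, H|].
  destruct H as [Hr H']. assert (Dz := z_at_D rad Hr).
  assert (N := Re_pos_neq _ (p1_pos _ Dz)).
  assert (N2 : p2 (z_at rad) <> 0) by (apply one_plus_neq_0, cz_lt, Dz).
  (* Here [g = z X p1] again and [f / g = p2], so that [f / g - 1 = c z]. *)
  eapply (extremal_upper_bound _ (fun z => p1 z * p2 z)%C).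
  2: exact (conj Hr H').
  2: apply cderiv_mult; [apply p1_deriv, Dz|apply p2_deriv].
  - split; [apply extremal_A; [apply mult_an; assumption|rewrite p1_0, p2_0; ring]|].
    exists (extremal p1). split; [apply extremal_A; assumption|].
    split; [apply extremal_chi, p1_pos|]. intros z Hz Nz.
    rewrite extremal_quot by assumption. unfold p2.
    replace (1 + c * z - 1)%C with (c * z)%C by ring. apply cz_lt, Hz.
  - apply Cmult_neq_0; assumption.
  - cbv beta. rewrite Ropp_plus_distr, RtoC_plus, <- p1_ratio, <- p2_ratio by exact Hr.
    field. repeat split; try assumption. apply one_minus_neq_0, cz_lt, Dz.
Qed.

Lemma radius_F3 rad : admissible (fun r => k_pos r + 0) rad -> Scar_radius (F3 chi) rad.
Proof.
  intros H. apply is_lub_of_mem; [apply radius_F3_mem, H|].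
  destruct H as [Hr H']. assert (Dz := z_at_D rad Hr).
  assert (N := Re_pos_neq _ (p1_pos _ Dz)).
  eapply (extremal_upper_bound _ p1).
  2: exact (conj Hr H').
  2: apply p1_deriv, Dz.
  - split; [apply extremal_A; assumption|apply extremal_chi, p1_pos].
  - exact N.
  - cbv beta. rewrite Rplus_0_r. apply p1_ratio, Hr.
Qed.

Lemma radii_model ra rb rc :
  admissible (fun r => k_pos r + k_pos r) ra ->
  admissible (fun r => k_pos r + k_disc r) rb ->
  admissible (fun r => k_pos r + 0) rc -> radii chi ra rb rc.
Proof.
  intros Ha Hb Hc. split; [|split].
  - apply radius_F1, Ha.
  - apply radius_F2, Hb.
  - apply radius_F3, Hc.
Qed.
End Model.

(** * The five model functions *)

(** [P] is the numerator of [A - B - k - 1/2] over the positive denominator [D], so the root of [P]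
    gives the equation at [rad] and monotonicity gives the strict inequality below it. All fifteen
    radii are below [1/4], so nothing has to be controlled beyond that. *)
Lemma admissible_decreasing (A B k P D : R -> R) rad :
  0 < rad <= 1 / 4 -> P rad = 0 ->
  (forall s t, 0 <= s < t -> t <= 1 / 4 -> P t < P s) ->
  (forall r, 0 <= r <= 1 / 4 ->
     1 / 2 < A r <= 3 / 2 /\ 0 < D r /\ (A r - B r - k r - 1 / 2) * D r = P r) ->
  admissible A B k rad.
Proof.
  intros Hr HP Hdec H. split; [lra|split].
  - destruct (H rad ltac:(lra)) as [_ [HD E]]. rewrite HP in E.
    apply Rmult_integral in E. lra.
  - intros r Hr'. destruct (H r ltac:(lra)) as [HA [HD E]]. split; [exact HA|].
    assert (Pr := Hdec r rad Hr' ltac:(lra)). rewrite HP, <- E in Pr.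
    apply Rnot_le_lt. intros N. nra.
Qed.

Lemma decreasing_root (P : R -> R) :
  continuity P -> 0 < P 0 -> P (1 / 4) < 0 ->
  (forall s t, 0 <= s < t -> t <= 1 / 4 -> P t < P s) ->
  exists r, 0 < r <= 1 / 4 /\ least_root_01 P r.
Proof.
  intros HC H0 H1 Hdec.
  destruct (IVT (fun x => - P x) 0 (1 / 4)) as [r [Hr E]]; try lra.
  - apply continuity_opp, HC.
  - assert (Pr : P r = 0) by lra.
    assert (0 < r) by (destruct (proj1 Hr) as [L|L]; [exact L|subst; lra]).
    exists r. split; [lra|]. split; [lra|split; [exact Pr|]].
    intros s Hs. specialize (Hdec s r ltac:(lra) ltac:(lra)). lra.
Qed.

Lemma Cmod_sqr (z : C) : RtoC (Cmod z * Cmod z) = (z * Cconj z)%C.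
Proof. rewrite <- Cmod2_conj. f_equal. ring. Qed.

(** The three Moebius terms below, with denominator [a], differ from the centre of their image
    circle by a multiple of [conj a / a], which is unimodular. Hence the disc lemmas are
    equalities. *)
Lemma Cmod_conj_ratio (a w : C) : a <> 0 -> Cmod (w * (Cconj a / a)) = Cmod w.
Proof.
  intros N. assert (P := proj1 (Cmod_gt_0 a) N).
  rewrite Cmod_mult, Cmod_div, Cmod_conj by exact N. field. lra.
Qed.

Lemma RtoC_neq (s : R) : s <> 0 -> RtoC s <> 0.
Proof. intros Hs E. apply RtoC_inj in E. auto. Qed.

Lemma Cconj_RtoC (r : R) : Cconj r = r.
Proof. unfold Cconj, RtoC; simpl. f_equal. ring. Qed.

Lemma disc_koebe (w : C) : Cmod w < 1 ->
  Cmod ((1 + w) / (1 - w) - RtoC ((1 + Cmod w * Cmod w) / (1 - Cmod w * Cmod w)))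
  = 2 * Cmod w / (1 - Cmod w * Cmod w).
Proof.
  intros H. assert (G := Cmod_ge_0 w). assert (N := one_minus_neq_0 w H).
  assert (D : 0 < 1 - Cmod w * Cmod w) by nra.
  assert (ND := RtoC_neq (1 - Cmod w * Cmod w) ltac:(lra)).
  rewrite RtoC_div by lra.
  replace ((1 + w) / (1 - w) - RtoC (1 + Cmod w * Cmod w) / RtoC (1 - Cmod w * Cmod w))%C
    with (2 * w / RtoC (1 - Cmod w * Cmod w) * (Cconj (1 - w) / (1 - w)))%C.
  - rewrite Cmod_conj_ratio by exact N.
    rewrite Cmod_div, Cmod_mult, !Cmod_R, !Rabs_pos_eq by (assumption || lra). reflexivity.
  - rewrite RtoC_minus, RtoC_plus, Cmod_sqr, Cminus_conj, Cconj_RtoC in *.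
    field. split; assumption.
Qed.

Lemma disc_inv (w : C) : Cmod w < 1 ->
  Cmod (1 / (1 + w) - RtoC (1 / (1 - Cmod w * Cmod w))) = Cmod w / (1 - Cmod w * Cmod w).
Proof.
  intros H. assert (G := Cmod_ge_0 w). assert (N := one_plus_neq_0 w H).
  assert (D : 0 < 1 - Cmod w * Cmod w) by nra.
  assert (ND := RtoC_neq (1 - Cmod w * Cmod w) ltac:(lra)).
  rewrite RtoC_div by lra.
  replace (1 / (1 + w) - 1 / RtoC (1 - Cmod w * Cmod w))%C
    with (- w / RtoC (1 - Cmod w * Cmod w) * (Cconj (1 + w) / (1 + w)))%C.
  - rewrite Cmod_conj_ratio by exact N.
    rewrite Cmod_div, Cmod_opp, !Cmod_R, !Rabs_pos_eq by (assumption || lra). reflexivity.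
  - rewrite RtoC_minus, Cmod_sqr, Cplus_conj, Cconj_RtoC in *.
    field. split; assumption.
Qed.

Lemma two_plus_neq_0 (w : C) : Cmod w < 1 -> (2 + w)%C <> 0.
Proof.
  intros H E. assert (T := Cmod_triangle_minus 2 (- w)).
  replace (2 - - w)%C with (2 + w)%C in T by ring.
  rewrite E, Cmod_0, Cmod_opp, Cmod_R, Rabs_pos_eq in T; lra.
Qed.

Lemma disc_quad (w : C) : Cmod w < 1 ->
  Cmod ((2 + 2 * w) / (2 + w)
    - RtoC ((4 - 2 * (Cmod w * Cmod w)) / (4 - Cmod w * Cmod w)))
  = 2 * Cmod w / (4 - Cmod w * Cmod w).
Proof.
  intros H. assert (G := Cmod_ge_0 w). assert (N := two_plus_neq_0 w H).
  assert (D : 0 < 4 - Cmod w * Cmod w) by nra.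
  assert (ND := RtoC_neq (4 - Cmod w * Cmod w) ltac:(lra)).
  rewrite RtoC_div by lra.
  replace ((2 + 2 * w) / (2 + w)
      - RtoC (4 - 2 * (Cmod w * Cmod w)) / RtoC (4 - Cmod w * Cmod w))%C
    with (2 * w / RtoC (4 - Cmod w * Cmod w) * (Cconj (2 + w) / (2 + w)))%C.
  - rewrite Cmod_conj_ratio by exact N.
    rewrite Cmod_div, Cmod_mult, !Cmod_R, !Rabs_pos_eq by (assumption || lra). reflexivity.
  - rewrite !RtoC_minus, (RtoC_mult 2), Cmod_sqr, Cplus_conj, Cconj_RtoC in *.
    field. split; assumption.
Qed.

Lemma Cconj_Ci : Cconj Ci = (- Ci)%C.
Proof. unfold Cconj, Ci, Copp; simpl. f_equal; ring. Qed.

Lemma Ci_sqr : (Ci * Ci)%C = (- (1))%C.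
Proof. unfold Ci, Cmult, Copp, RtoC; simpl. f_equal; ring. Qed.

Ltac cderiv_tac :=
  match goal with
  | |- cderiv (fun _ => ?a) _ _ => exact (cderiv_const a _)
  | |- cderiv (fun x => x) _ _ => apply cderiv_id
  | |- cderiv (fun x => Cplus (@?f x) (@?g x)) _ _ => apply (cderiv_plus f g); cderiv_tac
  | |- cderiv (fun x => Cminus (@?f x) (@?g x)) _ _ => apply (cderiv_minus f g); cderiv_tac
  | |- cderiv (fun x => Cmult (@?f x) (@?g x)) _ _ => apply (cderiv_mult f g); cderiv_tac
  end.

Lemma radii_a_of ra rb rc :
  admissible (fun _ => 1) (fun _ => 0) (fun r => k_pos r + k_pos r) ra ->
  admissible (fun _ => 1) (fun _ => 0) (fun r => k_pos r + k_disc r) rb ->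
  admissible (fun _ => 1) (fun _ => 0) (fun r => k_pos r + 0) rc ->
  radii chi_a ra rb rc.
Proof.
  apply (radii_model chi_a (fun _ => 1) (fun _ => 0) _ _ 1).
  - intros z _. unfold chi_a. ring.
  - intros z _. apply cderiv_const.
  - reflexivity.
  - intros z _. apply C1_nz.
  - intros z _. replace (1 + z * 0 / 1 - 1)%C with (RtoC 0) by field. rewrite Cmod_0. lra.
  - apply Cmod_1.
  - intros r _. rewrite Rminus_0_r. field.
Qed.

Lemma radii_b_of ra rb rc :
  let A r := 1 / (1 - r * r) in let B r := r / (1 - r * r) in
  admissible A B (fun r => k_pos r + k_pos r) ra ->
  admissible A B (fun r => k_pos r + k_disc r) rb ->
  admissible A B (fun r => k_pos r + 0) rc ->
  radii chi_b ra rb rc.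
Proof.
  intros A B.
  (* Here [1 + z X' / X = 1 / (1 + z)], smallest on [|z| = r] at [z = r]; that is [- r conj c] for
     [c = -1]. *)
  apply (radii_model chi_b (fun z => 1 / (1 + z))%C
    (fun z => - (1) / ((1 + z) * (1 + z)))%C A B (- (1))%C).
  - intros z Hz. unfold chi_b. field. apply one_plus_neq_0, Hz.
  - intros z Hz. assert (N := one_plus_neq_0 z Hz).
    eapply cderiv_eq; [|apply (cderiv_div (fun _ => RtoC 1) (fun z => 1 + z)%C);
      [cderiv_tac|cderiv_tac|exact N]].
    cbv beta. field. exact N.
  - cbv beta. rewrite Cplus_0_r. field.
  - intros z Hz E. assert (N := one_plus_neq_0 z Hz). apply C1_nz.
    transitivity ((1 / (1 + z)) * (1 + z))%C; [field; exact N|]. cbv beta in E.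
    rewrite E. ring.
  - intros z Hz. assert (N := one_plus_neq_0 z Hz). right. unfold A, B.
    rewrite <- (disc_inv z Hz). f_equal. field. exact N.
  - rewrite Cmod_opp. apply Cmod_1.
  - intros r Hr. unfold A, B.
    replace (Cconj (- (1))) with (- (1))%C by (rewrite Copp_conj, Cconj_RtoC; reflexivity).
    replace (- r * - (1))%C with (RtoC r) by ring.
    assert (N : (1 + r)%C <> 0) by (rewrite <- RtoC_plus; apply RtoC_neq; lra).
    replace (1 / (1 - r * r) - r / (1 - r * r)) with (1 / (1 + r)) by (field; nra).
    rewrite RtoC_div, RtoC_plus by lra. field. exact N.
Qed.

Lemma Cmod_sq_lt (z : C) : inD z -> Cmod (z * z) < 1.
Proof.
  unfold inD. intros H. rewrite Cmod_mult. assert (G := Cmod_ge_0 z). nra.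
Qed.

Lemma radii_c_of ra rb rc :
  let A r := (1 + r * r * (r * r)) / (1 - r * r * (r * r)) in
  let B r := 2 * (r * r) / (1 - r * r * (r * r)) in
  admissible A B (fun r => k_pos r + k_pos r) ra ->
  admissible A B (fun r => k_pos r + k_disc r) rb ->
  admissible A B (fun r => k_pos r + 0) rc ->
  radii chi_c ra rb rc.
Proof.
  intros A B.
  assert (NN : forall z, inD z -> (1 - z * z)%C <> 0)
    by (intros z Hz; apply one_minus_neq_0, Cmod_sq_lt, Hz).
  (* Here [1 + z X' / X = (1 + z^2) / (1 - z^2)], so [disc_koebe] is used at [z^2]. Its left end
     needs [z^2 = - r^2], that is [z = i r], which is why [c = Ci]. *)
  apply (radii_model chi_c (fun z => 1 / (1 - z * z))%C
    (fun z => 2 * z / ((1 - z * z) * (1 - z * z)))%C A B Ci).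
  - intros z Hz. unfold chi_c. field. apply NN, Hz.
  - intros z Hz. assert (N := NN z Hz).
    eapply cderiv_eq; [|apply (cderiv_div (fun _ => RtoC 1) (fun z => 1 - z * z)%C);
      [cderiv_tac|cderiv_tac|exact N]].
    cbv beta. field. exact N.
  - cbv beta. rewrite Cmult_0_r. field.
  - intros z Hz E. assert (N := NN z Hz). apply C1_nz.
    transitivity ((1 / (1 - z * z)) * (1 - z * z))%C; [field; exact N|]. cbv beta in E.
    rewrite E. ring.
  - intros z Hz. assert (N := NN z Hz). right. unfold A, B.
    assert (T := disc_koebe (z * z) (Cmod_sq_lt z Hz)).
    rewrite !(Cmod_mult z z) in T. rewrite <- T. f_equal. field. exact N.
  - apply Cmod_Ci.
  - intros r Hr. unfold A, B. rewrite Cconj_Ci.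
    set (z := (- r * - Ci)%C).
    assert (Ez : (z * z = - RtoC (r * r))%C).
    { unfold z. transitivity (r * r * (Ci * Ci))%C; [ring|].
      rewrite Ci_sqr, RtoC_mult. ring. }
    assert (H2 : 0 <= r * r < 1) by nra.
    assert (N : (1 + RtoC (r * r))%C <> 0) by (rewrite <- RtoC_plus; apply RtoC_neq; lra).
    replace ((1 + r * r * (r * r)) / (1 - r * r * (r * r))
      - 2 * (r * r) / (1 - r * r * (r * r))) with ((1 - r * r) / (1 + r * r))
      by (field; split; nra).
    rewrite RtoC_div, RtoC_plus, RtoC_minus by lra.
    transitivity (1 + 2 * (z * z) / (1 - z * z))%C.
    + assert (N' : (1 - z * z)%C <> 0).
      { rewrite Ez. replace (1 - - RtoC (r * r))%C with (1 + RtoC (r * r))%C by ring. exact N. }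
      field. exact N'.
    + rewrite Ez. field.
      exact N.
Qed.

Lemma radii_d_of ra rb rc :
  let A r := (1 + r * r) / (1 - r * r) in let B r := 2 * r / (1 - r * r) in
  admissible A B (fun r => k_pos r + k_pos r) ra ->
  admissible A B (fun r => k_pos r + k_disc r) rb ->
  admissible A B (fun r => k_pos r + 0) rc ->
  radii chi_d ra rb rc.
Proof.
  intros A B.
  apply (radii_model chi_d (fun z => 1 / ((1 - z) * (1 - z)))%C
    (fun z => 2 / ((1 - z) * (1 - z) * (1 - z)))%C A B 1).
  - intros z Hz. unfold chi_d. field. apply one_minus_neq_0, Hz.
  - intros z Hz. assert (N := one_minus_neq_0 z Hz).
    eapply cderiv_eq; [|apply (cderiv_div (fun _ => RtoC 1) (fun z => (1 - z) * (1 - z))%C);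
      [cderiv_tac|cderiv_tac|apply Cmult_neq_0; exact N]].
    cbv beta. field. exact N.
  - cbv beta. replace (1 - 0)%C with (RtoC 1) by ring. field.
  - intros z Hz E. assert (N := one_minus_neq_0 z Hz). apply C1_nz.
    transitivity ((1 / ((1 - z) * (1 - z))) * ((1 - z) * (1 - z)))%C; [field; exact N|].
    cbv beta in E. rewrite E. ring.
  - intros z Hz. assert (N := one_minus_neq_0 z Hz). right. unfold A, B.
    rewrite <- (disc_koebe z Hz). f_equal. field. exact N.
  - apply Cmod_1.
  - intros r Hr. unfold A, B. rewrite Cconj_RtoC, Cmult_1_r.
    assert (N : (1 + r)%C <> 0) by (rewrite <- RtoC_plus; apply RtoC_neq; lra).
    replace ((1 + r * r) / (1 - r * r) - 2 * r / (1 - r * r)) with ((1 - r) / (1 + r))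
      by (field; nra).
    rewrite RtoC_div, RtoC_plus, RtoC_minus by lra. field.
    replace (1 - - r)%C with (1 + r)%C by ring. auto.
Qed.

Lemma radii_e_of ra rb rc :
  let A r := (4 - 2 * (r * r)) / (4 - r * r) in let B r := 2 * r / (4 - r * r) in
  admissible A B (fun r => k_pos r + k_pos r) ra ->
  admissible A B (fun r => k_pos r + k_disc r) rb ->
  admissible A B (fun r => k_pos r + 0) rc ->
  radii chi_e ra rb rc.
Proof.
  intros A B.
  assert (E2 : forall z, (1 + z / 2 = (2 + z) / 2)%C) by (intros z; field).
  (* Here [1 + z X' / X = (2 + 2 z) / (2 + z)], whose left end on [|z| = r] is at [z = - r], so
     [c = 1]. *)
  apply (radii_model chi_e (fun z => 1 + z / 2)%C (fun z => 1 / 2)%C A B 1).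
  - intros z Hz. unfold chi_e. field.
  - intros z Hz. unfold Cdiv.
    eapply cderiv_eq; [|cderiv_tac]. cbv beta. ring.
  - cbv beta. field.
  - intros z Hz E. apply (two_plus_neq_0 z Hz).
    transitivity (2 * (1 + z / 2))%C; [field|]. cbv beta in E. rewrite E. ring.
  - intros z Hz. assert (N := two_plus_neq_0 z Hz). right. unfold A, B.
    rewrite <- (disc_quad z Hz). f_equal. rewrite E2. field. exact N.
  - apply Cmod_1.
  - intros r Hr. unfold A, B. rewrite Cconj_RtoC, Cmult_1_r, E2.
    assert (N : (2 + - r)%C <> 0)
      by (rewrite <- RtoC_opp, <- RtoC_plus; apply RtoC_neq; lra).
    replace ((4 - 2 * (r * r)) / (4 - r * r) - 2 * r / (4 - r * r)) with ((2 - 2 * r) / (2 + - r))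
      by (field; split; nra).
    rewrite RtoC_div, RtoC_plus, RtoC_minus, RtoC_mult, RtoC_opp by lra. field. exact N.
Qed.

(** * Numerical radii *)

(** The difference of the two sides is [t - s] times a bracket. For [s < t <= 1/4] the cofactors of
    [a2], [a3], [a4] lie between 0 and [1/2], [3/16], [1/16]; [Rmin 0] keeps the worst case of
    negative coefficients only. *)
Lemma quartic_decreasing a0 a1 a2 a3 a4 :
  0 < a1 + Rmin 0 a2 / 2 + Rmin 0 a3 * 3 / 16 + Rmin 0 a4 / 16 ->
  forall s t, 0 <= s < t -> t <= 1 / 4 ->
    a0 - a1 * t - a2 * t ^ 2 - a3 * t ^ 3 - a4 * t ^ 4
    < a0 - a1 * s - a2 * s ^ 2 - a3 * s ^ 3 - a4 * s ^ 4.
Proof.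
  intros Ha s t Hs Ht.
  assert (M : forall a u m, 0 <= u <= m -> Rmin 0 a * m <= a * u).
  { intros a u m Hu. assert (L := Rmin_l 0 a). assert (L' := Rmin_r 0 a). nra. }
  assert (S2 : 0 <= s * s <= 1 / 16) by nra.
  assert (T2 : 0 <= t * t <= 1 / 16) by nra.
  assert (ST : 0 <= s * t <= 1 / 16) by nra.
  assert (M2 := M a2 (t + s) (1 / 2) ltac:(lra)).
  assert (M3 := M a3 (t * t + s * t + s * s) (3 / 16) ltac:(lra)).
  assert (M4 := M a4 ((t + s) * (t * t + s * s)) (1 / 16) ltac:(nra)).
  assert (0 < (t - s) * (a1 + a2 * (t + s) + a3 * (t * t + s * t + s * s)
    + a4 * ((t + s) * (t * t + s * s)))) by (apply Rmult_lt_0_compat; lra).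
  lra.
Qed.

Lemma sqrt_between a x b : 0 <= a -> 0 <= b -> a * a < x < b * b -> a < sqrt x < b.
Proof.
  intros Ha Hb [H1 H2]. rewrite <- (sqrt_square a Ha), <- (sqrt_square b Hb) at 1.
  split; apply sqrt_lt_1; nra.
Qed.

Ltac quartic a0 a1 a2 a3 a4 :=
  let s := fresh "s" in let t := fresh "t" in let H1 := fresh "H" in let H2 := fresh "H" in
  intros s t H1 H2;
  assert (K := quartic_decreasing a0 a1 a2 a3 a4
    ltac:(unfold Rmin; repeat destruct (Rle_dec _ _); lra) s t H1 H2); simpl; simpl in K; lra.

Lemma div_between x y a b : 0 < y -> a * y < x -> x <= b * y -> a < x / y <= b.
Proof.
  intros Hy H1 H2. split.
  - apply Rmult_lt_reg_r with y; [exact Hy|]. unfold Rdiv. rewrite Rmult_assoc, Rinv_l; lra.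
  - apply Rmult_le_reg_r with y; [exact Hy|]. unfold Rdiv. rewrite Rmult_assoc, Rinv_l; lra.
Qed.

Ltac margin :=
  let r := fresh "r" in let Hr := fresh "Hr" in
  intros r Hr; cbv beta;
  assert (0 <= r * r <= 1 / 16) by nra;
  assert (0 <= r * r * (r * r) <= 1 / 256) by nra;
  split; [first [lra | apply div_between; lra]|split; [nra|]];
  unfold k_pos, k_disc; field; repeat split; nra.

Lemma radii_chi_a : radii chi_a (1 / (4 + sqrt 17)) (1 / (3 + 2 * sqrt 3)) (1 / (2 + sqrt 5)).
Proof.
  assert (B17 := sqrt_between 4 17 (17 / 4) ltac:(lra) ltac:(lra) ltac:(lra)).
  assert (B3 := sqrt_between (3 / 2) 3 (7 / 4) ltac:(lra) ltac:(lra) ltac:(lra)).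
  assert (B5 := sqrt_between 2 5 (9 / 4) ltac:(lra) ltac:(lra) ltac:(lra)).
  assert (E17 := sqrt_sqrt 17 ltac:(lra)). assert (E3 := sqrt_sqrt 3 ltac:(lra)).
  assert (E5 := sqrt_sqrt 5 ltac:(lra)).
  set (q17 := sqrt 17) in *. set (q3 := sqrt 3) in *. set (q5 := sqrt 5) in *.
  (* Rationalising the radii turns the root equation into one linear in the square root and its
     square, which [E17], [E3], [E5] settle. *)
  replace (1 / (4 + q17)) with (q17 - 4)
    by (apply Rmult_eq_reg_r with (4 + q17); [field_simplify; lra|lra]).
  replace (1 / (3 + 2 * q3)) with ((2 * q3 - 3) / 3)
    by (apply Rmult_eq_reg_r with (3 + 2 * q3); [field_simplify; lra|lra]).
  replace (1 / (2 + q5)) with (q5 - 2)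
    by (apply Rmult_eq_reg_r with (2 + q5); [field_simplify; lra|lra]).
  apply radii_a_of.
  - apply (admissible_decreasing _ _ _ (fun r => 1 - 8 * r - r ^ 2) (fun r => 2 * (1 - r * r)));
      [lra|lra|quartic 1 8 1 0 0|margin].
  - apply (admissible_decreasing _ _ _ (fun r => 1 - 6 * r - 3 * r ^ 2) (fun r => 2 * (1 - r * r)));
      [lra|lra|quartic 1 6 3 0 0|margin].
  - apply (admissible_decreasing _ _ _ (fun r => 1 - 4 * r - r ^ 2) (fun r => 2 * (1 - r * r)));
      [lra|lra|quartic 1 4 1 0 0|margin].
Qed.

Lemma radii_chi_b : radii chi_b (5 - 2 * sqrt 6) (sqrt 17 - 4) (3 - 2 * sqrt 2).
Proof.
  assert (B6 := sqrt_between (19 / 8) 6 (5 / 2) ltac:(lra) ltac:(lra) ltac:(lra)).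
  assert (B17 := sqrt_between 4 17 (17 / 4) ltac:(lra) ltac:(lra) ltac:(lra)).
  assert (B2 := sqrt_between (11 / 8) 2 (3 / 2) ltac:(lra) ltac:(lra) ltac:(lra)).
  assert (E6 := sqrt_sqrt 6 ltac:(lra)). assert (E17 := sqrt_sqrt 17 ltac:(lra)).
  assert (E2 := sqrt_sqrt 2 ltac:(lra)).
  apply radii_b_of.
  - apply (admissible_decreasing _ _ _ (fun r => 1 - 10 * r + r ^ 2) (fun r => 2 * (1 - r * r)));
      [lra|lra|quartic 1 10 (-1) 0 0|margin].
  - apply (admissible_decreasing _ _ _ (fun r => 1 - 8 * r - r ^ 2) (fun r => 2 * (1 - r * r)));
      [lra|lra|quartic 1 8 1 0 0|margin].
  - apply (admissible_decreasing _ _ _ (fun r => 1 - 6 * r + r ^ 2) (fun r => 2 * (1 - r * r)));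
      [lra|lra|quartic 1 6 (-1) 0 0|margin].
Qed.

Lemma radii_chi_d : radii chi_d ((6 - sqrt 33) / 3) (5 - 2 * sqrt 6) ((4 - sqrt 13) / 3).
Proof.
  assert (B33 := sqrt_between (21 / 4) 33 6 ltac:(lra) ltac:(lra) ltac:(lra)).
  assert (B6 := sqrt_between (19 / 8) 6 (5 / 2) ltac:(lra) ltac:(lra) ltac:(lra)).
  assert (B13 := sqrt_between (13 / 4) 13 4 ltac:(lra) ltac:(lra) ltac:(lra)).
  assert (E33 := sqrt_sqrt 33 ltac:(lra)). assert (E6 := sqrt_sqrt 6 ltac:(lra)).
  assert (E13 := sqrt_sqrt 13 ltac:(lra)).
  apply radii_d_of.
  - apply (admissible_decreasing _ _ _ (fun r => 1 - 12 * r + 3 * r ^ 2) (fun r => 2 * (1 - r * r)));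
      [lra|lra|quartic 1 12 (-3) 0 0|margin].
  - apply (admissible_decreasing _ _ _ (fun r => 1 - 10 * r + r ^ 2) (fun r => 2 * (1 - r * r)));
      [lra|lra|quartic 1 10 (-1) 0 0|margin].
  - apply (admissible_decreasing _ _ _ (fun r => 1 - 8 * r + 3 * r ^ 2) (fun r => 2 * (1 - r * r)));
      [lra|lra|quartic 1 8 (-3) 0 0|margin].
Qed.

Lemma radii_chi_c :
  exists r1 r2 r3,
     least_root_01 (fun r => 3 * r ^ 4 - 8 * r ^ 3 - 4 * r ^ 2 - 8 * r + 1) r1 /\
     least_root_01 (fun r => r ^ 4 - 6 * r ^ 3 - 6 * r ^ 2 - 6 * r + 1) r2 /\
     least_root_01 (fun r => 3 * r ^ 4 - 4 * r ^ 3 - 4 * r ^ 2 - 4 * r + 1) r3 /\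
     radii chi_c r1 r2 r3.
Proof.
  assert (D1 : forall s t, 0 <= s < t -> t <= 1 / 4 ->
    3 * t ^ 4 - 8 * t ^ 3 - 4 * t ^ 2 - 8 * t + 1 < 3 * s ^ 4 - 8 * s ^ 3 - 4 * s ^ 2 - 8 * s + 1)
    by quartic 1 8 4 8 (-3).
  assert (D2 : forall s t, 0 <= s < t -> t <= 1 / 4 ->
    t ^ 4 - 6 * t ^ 3 - 6 * t ^ 2 - 6 * t + 1 < s ^ 4 - 6 * s ^ 3 - 6 * s ^ 2 - 6 * s + 1)
    by quartic 1 6 6 6 (-1).
  assert (D3 : forall s t, 0 <= s < t -> t <= 1 / 4 ->
    3 * t ^ 4 - 4 * t ^ 3 - 4 * t ^ 2 - 4 * t + 1 < 3 * s ^ 4 - 4 * s ^ 3 - 4 * s ^ 2 - 4 * s + 1)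
    by quartic 1 4 4 4 (-3).
  destruct (decreasing_root (fun r => 3 * r ^ 4 - 8 * r ^ 3 - 4 * r ^ 2 - 8 * r + 1))
    as [r1 [B1 L1]]; [reg|lra|lra|exact D1|].
  destruct (decreasing_root (fun r => r ^ 4 - 6 * r ^ 3 - 6 * r ^ 2 - 6 * r + 1))
    as [r2 [B2 L2]]; [reg|lra|lra|exact D2|].
  destruct (decreasing_root (fun r => 3 * r ^ 4 - 4 * r ^ 3 - 4 * r ^ 2 - 4 * r + 1))
    as [r3 [B3 L3]]; [reg|lra|lra|exact D3|].
  exists r1, r2, r3. split; [exact L1|split; [exact L2|split; [exact L3|]]].
  apply radii_c_of.
  (* The common denominator is [1 - r^4], since [k_pos] and [k_disc] have denominators dividing
     [1 - r^2]. *)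
  - apply (admissible_decreasing _ _ _ _ (fun r => 2 * (1 - r * r * (r * r))) _
      B1 (proj1 (proj2 L1)) D1). margin.
  - apply (admissible_decreasing _ _ _ _ (fun r => 2 * (1 - r * r * (r * r))) _
      B2 (proj1 (proj2 L2)) D2). margin.
  - apply (admissible_decreasing _ _ _ _ (fun r => 2 * (1 - r * r * (r * r))) _
      B3 (proj1 (proj2 L3)) D3). margin.
Qed.

Lemma radii_chi_e :
  exists s1 s2 s3,
     least_root_01 (fun r => 3 * r ^ 3 + 6 * r ^ 2 - 19 * r + 2) s1 /\
     least_root_01 (fun r => 5 * r ^ 3 - 15 * r + 2) s2 /\
     least_root_01 (fun r => 3 * r ^ 3 + 2 * r ^ 2 - 11 * r + 2) s3 /\
     radii chi_e s1 s2 s3.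
Proof.
  assert (D1 : forall s t, 0 <= s < t -> t <= 1 / 4 ->
    3 * t ^ 3 + 6 * t ^ 2 - 19 * t + 2 < 3 * s ^ 3 + 6 * s ^ 2 - 19 * s + 2)
    by quartic 2 19 (-6) (-3) 0.
  assert (D2 : forall s t, 0 <= s < t -> t <= 1 / 4 ->
    5 * t ^ 3 - 15 * t + 2 < 5 * s ^ 3 - 15 * s + 2)
    by quartic 2 15 0 (-5) 0.
  assert (D3 : forall s t, 0 <= s < t -> t <= 1 / 4 ->
    3 * t ^ 3 + 2 * t ^ 2 - 11 * t + 2 < 3 * s ^ 3 + 2 * s ^ 2 - 11 * s + 2)
    by quartic 2 11 (-2) (-3) 0.
  destruct (decreasing_root (fun r => 3 * r ^ 3 + 6 * r ^ 2 - 19 * r + 2))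
    as [r1 [B1 L1]]; [reg|lra|lra|exact D1|].
  destruct (decreasing_root (fun r => 5 * r ^ 3 - 15 * r + 2))
    as [r2 [B2 L2]]; [reg|lra|lra|exact D2|].
  destruct (decreasing_root (fun r => 3 * r ^ 3 + 2 * r ^ 2 - 11 * r + 2))
    as [r3 [B3 L3]]; [reg|lra|lra|exact D3|].
  exists r1, r2, r3. split; [exact L1|split; [exact L2|split; [exact L3|]]].
  apply radii_e_of.
  (* [A - B] reduces to [(2 - 2 r) / (2 - r)]: the factor [2 + r] of [4 - r^2] cancels, which keeps
     the numerator cubic. *)
  - apply (admissible_decreasing _ _ _ _ (fun r => 2 * ((2 - r) * (1 - r * r))) _
      B1 (proj1 (proj2 L1)) D1). margin.
  - apply (admissible_decreasing _ _ _ _ (fun r => 2 * ((2 - r) * (1 - r * r))) _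
      B2 (proj1 (proj2 L2)) D2). margin.
  - apply (admissible_decreasing _ _ _ _ (fun r => 2 * ((2 - r) * (1 - r * r))) _
      B3 (proj1 (proj2 L3)) D3). margin.
Qed.

Theorem theorem6p1 :
  radii chi_a (1 / (4 + sqrt 17)) (1 / (3 + 2 * sqrt 3)) (1 / (2 + sqrt 5)) /\
  radii chi_b (5 - 2 * sqrt 6) (sqrt 17 - 4) (3 - 2 * sqrt 2) /\
  (exists r1 r2 r3,
     least_root_01 (fun r => 3 * r ^ 4 - 8 * r ^ 3 - 4 * r ^ 2 - 8 * r + 1) r1 /\
     least_root_01 (fun r => r ^ 4 - 6 * r ^ 3 - 6 * r ^ 2 - 6 * r + 1) r2 /\
     least_root_01 (fun r => 3 * r ^ 4 - 4 * r ^ 3 - 4 * r ^ 2 - 4 * r + 1) r3 /\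
     radii chi_c r1 r2 r3) /\
  radii chi_d ((6 - sqrt 33) / 3) (5 - 2 * sqrt 6) ((4 - sqrt 13) / 3) /\
  (exists s1 s2 s3,
     least_root_01 (fun r => 3 * r ^ 3 + 6 * r ^ 2 - 19 * r + 2) s1 /\
     least_root_01 (fun r => 5 * r ^ 3 - 15 * r + 2) s2 /\
     least_root_01 (fun r => 3 * r ^ 3 + 2 * r ^ 2 - 11 * r + 2) s3 /\
     radii chi_e s1 s2 s3).
Proof.
  split; [exact radii_chi_a|split; [exact radii_chi_b|split; [exact radii_chi_c|]]].
  split; [exact radii_chi_d|exact radii_chi_e].
Qed.
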